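(* Let $\eta_0>0$, let $n,m\ge0$ be integers and $\nu,\mu\in\{1,-1\}$. The normal derivative on $\partial\Omega_{\eta_0}$ of the interior toroidal harmonic $I_{n,m}^{\nu,\mu}=I_{n,m}^{\nu,\mu}[\eta_0]$ is $$\operatorname{nor}I_{n,m}^{\nu,\mu}=\frac{(\cosh\eta_0-\cos\theta)^{1/2}}{4\sinh\eta_0}\,\Phi_m^\mu(\varphi)\Big(A\,\Phi_{n-1}^\nu(\theta)+B\,\Phi_n^\nu(\theta)+A\,\Phi_{n+1}^\nu(\theta)\Big),$$ where $$A=(1+2n)\cosh\eta_0-\big(2(n-m)+1\big)\frac{Q_{n+1/2}^m(\cosh\eta_0)}{Q_{n-1/2}^m(\cosh\eta_0)},$$ $$B=-2\left(2n\cosh^2\eta_0+1-\big(2(n-m)+1\big)\cosh\eta_0\,\frac{Q_{n+1/2}^m(\cosh\eta_0)}{Q_{n-1/2}^m(\cosh\eta_0)}\right).$$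
   Context: Toroidal coordinates $(\eta,\theta,\varphi)$, $\eta\in(0,\infty)$, $\theta\in[-\pi,\pi]$, $\varphi\in(-\pi,\pi]$, on $\mathbb{R}^3$: $x_0=\frac{\sin\theta}{\cosh\eta-\cos\theta}$, $x_1=\frac{\sinh\eta\cos\varphi}{\cosh\eta-\cos\theta}$, $x_2=\frac{\sinh\eta\sin\varphi}{\cosh\eta-\cos\theta}$. Let $S^1=\{x_0=0,\ x_1^2+x_2^2=1\}$ and $\Omega_{\eta_0}=\{x:\eta>\eta_0\}\cup S^1$ (an open solid torus) with boundary $\partial\Omega_{\eta_0}=\{\eta=\eta_0\}$. The normal derivative is $\operatorname{nor}f(x)=\operatorname{grad}f(x)\cdot\mathbf n$ for $x\in\partial\Omega_{\eta_0}$, where $\mathbf n=x_\eta/|x_\eta|$ ($x_\eta=\partial x/\partial\eta$) is the inward unit normal; equivalently $\operatorname{nor}f=\frac{1}{|x_\eta|}\frac{\partial f}{\partial\eta}\big|_{\eta=\eta_0^+}$. For any integer $k$, $\Phi_k^{\nu}(\theta)=\cos k\theta$ if $\nu=1$ and $\sin k\theta$ if $\nu=-1$. Legendre functions of the second kind, for $t>1$, real $k>-1$, integer $m\ge0$: $$Q_k^m(t)=\frac{(-1)^m}{2^{k+1}}\frac{\Gamma(k+m+1)}{\Gamma(k+1)}(t^2-1)^{m/2}\int_{-1}^1\frac{(1-s^2)^k}{(t-s)^{k+m+1}}\,ds.$$ Interior toroidal harmonics: $$I_{n,m}^{\nu,\mu}[\eta_0](\eta,\theta,\varphi)=\sqrt{\cosh\eta-\cos\theta}\;\frac{Q_{n-1/2}^m(\cosh\eta)}{Q_{n-1/2}^m(\cosh\eta_0)}\,\Phi_n^\nu(\theta)\,\Phi_m^\mu(\varphi).$$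 *)

(* Defs.v *)
From HB Require Import structures.
From mathcomp Require Import all_boot all_order all_algebra.
From mathcomp Require Import all_classical all_reals all_analysis.

Set Implicit Arguments.
Unset Strict Implicit.
Unset Printing Implicit Defensive.

Import Order.TTheory GRing.Theory Num.Theory.
Import numFieldNormedType.Exports.

Local Open Scope classical_set_scope.
Local Open Scope ring_scope.

Definition cosh (R : realType) (x : R) : R := (expR x + expR (- x)) / 2.

Definition sinh (R : realType) (x : R) : R := (expR x - expR (- x)) / 2.

(* Euler's Gamma function, meaningful for x > 0. *)
Definition Gamma (R : realType) (x : R) : R :=
  \int[lebesgue_measure]_(t in `]0, +oo[) (t `^ (x - 1) * expR (- t)).

(* Q_k^m(t), meaningful for k > -1 and t > 1.  When k < 0 the integrand is
   singular at s = -1 and s = 1; the Lebesgue integral is still finite, and the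
   conventional value of [powR] at these two points is irrelevant. *)
Definition legendreQ (R : realType) (k : R) (m : nat) (t : R) : R :=
  (-1) ^+ m / 2 `^ (k + 1)
  * (Gamma (k + m%:R + 1) / Gamma (k + 1))
  * (t ^+ 2 - 1) `^ (m%:R / 2)
  * \int[lebesgue_measure]_(s in `[-1, 1])
      ((1 - s ^+ 2) `^ k / (t - s) `^ (k + m%:R + 1)).

(* Phi_k^nu, used only for nu = 1 and nu = -1. *)
Definition Phi (R : realType) (nu k : int) (theta : R) : R :=
  if nu == 1 then cos (k%:~R * theta) else sin (k%:~R * theta).

Definition toroidal_point (R : realType) (eta theta phi : R) : 'rV[R]_3 :=
  \row_(i < 3)
    [:: sin theta / (cosh eta - cos theta);
        sinh eta * cos phi / (cosh eta - cos theta);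
        sinh eta * sin phi / (cosh eta - cos theta)]`_i.

(* The coordinate domain.  As theta = -pi and theta = pi give the same point,
   theta is determined by the point only up to this identification. *)
Definition toroidal_domain (R : realType) : set (R * R * R) :=
  [set p | [/\ 0 < p.1.1, - pi <= p.1.2 <= pi & - pi < p.2 <= pi]].

(* Toroidal coordinates (eta, theta, phi) of a point x.  The default (0, 0, 0)
   is reached exactly on the x_0-axis and on the circle S^1. *)
Definition toroidal_coords (R : realType) (x : 'rV[R]_3) : R * R * R :=
  xget (0, 0, 0)
    [set p | toroidal_domain p /\ toroidal_point p.1.1 p.1.2 p.2 = x].

(* I_{n,m}^{nu,mu}[eta0] in toroidal coordinates. *)
Definition harmonic_coords (R : realType) (eta0 : R) (n m : nat) (nu mu : int)
    (eta theta phi : R) : R :=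
  Num.sqrt (cosh eta - cos theta)
  * (legendreQ (n%:R - 1 / 2) m (cosh eta)
     / legendreQ (n%:R - 1 / 2) m (cosh eta0))
  * Phi nu n%:Z theta * Phi mu m%:Z phi.

(* The same harmonic as a function of the point.  It does not depend on the
   choice made by [toroidal_coords]: Phi nu n%:Z is 2 pi-periodic.  The values
   on the x_0-axis and on S^1, both away from the tori eta = eta0, are
   conventional. *)
Definition interior_harmonic (R : realType) (eta0 : R) (n m : nat)
    (nu mu : int) (x : 'rV[R]_3) : R :=
  let p := toroidal_coords x in
  harmonic_coords eta0 n m nu mu p.1.1 p.1.2 p.2.

Definition gradient (R : realType) (f : 'rV[R]_3 -> R) (x : 'rV[R]_3) :
    'rV[R]_3 :=
  \row_(i < 3) 'D_(delta_mx 0 i) f x.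

Definition dot (R : realType) (u v : 'rV[R]_3) : R :=
  \sum_(i < 3) u 0 i * v 0 i.

(* The library norm on ['rV[R]_3] is the sup norm, whence this one. *)
Definition euclidean_norm (R : realType) (v : 'rV[R]_3) : R :=
  Num.sqrt (dot v v).

(* n = x_eta / |x_eta| at the point with coordinates (eta, theta, phi). *)
Definition inward_normal (R : realType) (eta theta phi : R) : 'rV[R]_3 :=
  let x_eta := derive1 (fun e : R => toroidal_point e theta phi) eta in
  (euclidean_norm x_eta)^-1 *: x_eta.

(* nor f at the point (eta0, theta, phi) of the torus eta = eta0. *)
Definition nor (R : realType) (f : 'rV[R]_3 -> R) (eta0 theta phi : R) : R :=
  dot (gradient f (toroidal_point eta0 theta phi))
      (inward_normal eta0 theta phi).

Definition nor_coefA (R : realType) (eta0 : R) (n m : nat) : R :=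
  (1 + 2 * n%:R) * cosh eta0
  - (2 * (n%:R - m%:R) + 1)
    * (legendreQ (n%:R + 1 / 2) m (cosh eta0)
       / legendreQ (n%:R - 1 / 2) m (cosh eta0)).

Definition nor_coefB (R : realType) (eta0 : R) (n m : nat) : R :=
  - 2 * (2 * n%:R * cosh eta0 ^+ 2 + 1
         - (2 * (n%:R - m%:R) + 1) * cosh eta0
           * (legendreQ (n%:R + 1 / 2) m (cosh eta0)
              / legendreQ (n%:R - 1 / 2) m (cosh eta0))).

(* Main.v *)
(* The normal derivative is [|x_eta|^-1] times the derivative in eta, and
   [|x_eta| = 1 / (cosh eta - cos theta)], so everything reduces to the
   derivative of [Q_k^m], k = n - 1/2, given by
     [(t^2 - 1) Q_k^m'(t) = (k - m + 1) Q_{k+1}^m(t) - (k + 1) t Q_k^m(t)].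
   Writing [J_{k,p}(t)] for the integral of [(1 - s^2)^k / (t - s)^p] over
   [-1, 1], this identity follows from [J_{k,p}' = - p J_{k,p+1}]
   (differentiation under the integral sign), from [Gamma (x + 1) = x Gamma x],
   and from integrating the derivative of [(1 - s^2)^(k+1) / (t - s)^p], which
   vanishes at both ends.
   The coordinates jump at theta = pi and at phi = pi.  The harmonic is
   nevertheless differentiable there, because cosh eta, cos theta, sin theta,
   cos phi and sin phi are smooth functions of the point, and cos (n theta),
   sin (n theta) are polynomials in cos theta, sin theta. *)
Require Import Defs.
From HB Require Import structures.
From mathcomp Require Import all_boot all_order all_algebra.
From mathcomp Require Import all_classical all_reals all_analysis.
From mathcomp Require Import measurable_realfun ring lra.

Import Order.TTheory GRing.Theory Num.Theory.
Import numFieldNormedType.Exports.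

Set Implicit Arguments.
Unset Strict Implicit.
Unset Printing Implicit Defensive.

Local Open Scope classical_set_scope.
Local Open Scope ring_scope.

(** * Integrals over increasing unions of segments *)

Lemma within_itv_continuous (R : realType) (f : R -> R) (a b : R) :
  (forall x, a <= x <= b -> {for x, continuous f}) ->
  {within `[a, b], continuous f}.
Proof.
move=> cf; apply: continuous_in_subspaceT => x; rewrite inE/= in_itv/=.
exact: cf.
Qed.

(** The hypotheses are two-sided at a and b as well, because the segments it serves lie inside an
    open interval on which F is differentiable. *)
Lemma FTC2_is_derive (R : realType) (f F : R -> R) (a b : R) : a < b ->
  (forall x, a <= x <= b -> {for x, continuous f}) ->
  (forall x, a <= x <= b -> is_derive x 1 F (f x)) ->
  (\int[lebesgue_measure]_(x in `[a, b]) (f x)%:E = (F b)%:E - (F a)%:E)%E.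
Proof.
move=> ab cf dF.
have cF x : a <= x <= b -> {for x, continuous F}.
  move=> /dF dFx; apply: differentiable_continuous.
  exact/derivable1_diffP/ex_derive.
have /continuous_within_itvP : {within `[a, b], continuous F}.
  exact: within_itv_continuous.
move=> /(_ ab) [cF1 Fa Fb].
apply: continuous_FTC2 => //.
- exact: within_itv_continuous.
- split => // x; rewrite in_itv/= => /andP[ax xb].
  by apply/ex_derive; apply: dF; rewrite !ltW.
- move=> x; rewrite in_itv/= => /andP[ax xb]; rewrite derive1E.
  have dFx : is_derive x 1 F (f x) by apply: dF; rewrite !ltW.
  exact: derive_val.
Qed.

Lemma measurable_bigcup_itv (R : realType) (a b : R^nat) :
  measurable (\bigcup_n `[a n, b n]%classic : set R).
Proof. by apply: bigcup_measurable => n _; exact: measurable_itv. Qed.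

Lemma nondecreasing_itv (R : realType) (a b : R^nat) :
  nonincreasing_seq a -> nondecreasing_seq b ->
  nondecreasing_seq (fun n => `[a n, b n]%classic : set R).
Proof.
move=> na nb i j ij; apply/subsetPset; apply: subset_itv; rewrite bnd_simp.
  exact: na.
exact: nb.
Qed.

Lemma measurable_fun_bigcup_itv (R : realType) (a b : R^nat) (f : R -> R) :
  (forall n x, a n <= x <= b n -> {for x, continuous f}) ->
  measurable_fun (\bigcup_n `[a n, b n]%classic) f.
Proof.
move=> cf; apply/measurable_fun_bigcup => n; first exact: measurable_itv.
apply: subspace_continuous_measurable_fun => //.
by apply: within_itv_continuous; exact: cf.
Qed.

(** Monotone convergence: the integrals over the segments equal F (b n) - F (a n), so their limit is
    at most M. A bounded primitive thus yields integrability up to singular or infinite ends. *)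
Lemma ge0_integrable_bigcup_itv (R : realType) (a b : R^nat) (f F : R -> R)
    (M : R) :
  (forall n, a n < b n) -> nonincreasing_seq a -> nondecreasing_seq b ->
  (forall n x, a n <= x <= b n -> 0 <= f x) ->
  (forall n x, a n <= x <= b n -> {for x, continuous f}) ->
  (forall n x, a n <= x <= b n -> is_derive x 1 F (f x)) ->
  (forall n, F (b n) - F (a n) <= M) ->
  lebesgue_measure.-integrable (\bigcup_n `[a n, b n]%classic) (EFin \o f).
Proof.
move=> ab na nb f0 cf dF FM.
have mf := measurable_fun_bigcup_itv cf.
apply/integrableP; split; first exact/measurable_EFinP.
apply: (@le_lt_trans _ _ M%:E); last exact: ltry.
under eq_integral => x do rewrite /=.
have mfn n : measurable_fun `[a n, b n] (fun x => `|(f x)%:E|%E).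
  apply: measurableT_comp => //; apply/measurable_EFinP.
  by apply: measurable_funS mf; [exact: measurable_bigcup_itv|by move=> x; exists n].
have h : (\int[lebesgue_measure]_(x in `[a n, b n]) `|(f x)%:E| @[n --> \oo] -->
    \int[lebesgue_measure]_(x in \bigcup_n `[a n, b n]%classic) `|(f x)%:E|)%E.
  apply: ge0_nondecreasing_set_cvg_integral => //.
  exact: nondecreasing_itv.
apply: (cvge_le _ h).
apply: nearW => n /=.
have -> : (\int[lebesgue_measure]_(x in `[a n, b n]) `|f x|%:E =
    \int[lebesgue_measure]_(x in `[a n, b n]) (f x)%:E)%E.
  apply: eq_integral => x; rewrite inE/= in_itv/= => /f0 fx.
  by rewrite ger0_norm.
rewrite (@FTC2_is_derive _ _ F)//; by [exact: cf|exact: dF|rewrite lee_fin].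
Qed.

(** Here f may change sign, so the restrictions of f to the segments are handled by dominated
    convergence, with |f| as dominating function. It serves to integrate a derivative whose
    primitive has limits at the ends. *)
Lemma Rintegral_bigcup_itv (R : realType) (a b : R^nat) (f F : R -> R)
    (l : R) :
  (forall n, a n < b n) -> nonincreasing_seq a -> nondecreasing_seq b ->
  (forall n x, a n <= x <= b n -> {for x, continuous f}) ->
  (forall n x, a n <= x <= b n -> is_derive x 1 F (f x)) ->
  lebesgue_measure.-integrable (\bigcup_n `[a n, b n]%classic) (EFin \o f) ->
  F (b n) - F (a n) @[n --> \oo] --> l ->
  \int[lebesgue_measure]_(x in \bigcup_n `[a n, b n]%classic) f x = l.
Proof.
move=> ab na nb cf dF intf Fl.
set D := \bigcup_n _ in intf *.
have mD : measurable D by exact: measurable_bigcup_itv.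
have sD n : `[a n, b n]%classic `<=` D by move=> x; exists n.
have mf := measurable_int _ intf.
pose fn n := (EFin \o f) \_ (`[a n, b n]%classic : set R).
have mfn n : measurable_fun D (fn n).
  apply/measurable_restrict => //.
  apply: measurable_funS mf => //; exact: subIsetl.
have fnf x : D x -> fn ^~ x @ \oo --> (f x)%:E.
  move=> [N _ DN]; apply: cvg_near_cst; exists N => // n /= Nn.
  rewrite /fn patchE mem_set//=.
  by have /subsetPset := nondecreasing_itv na nb Nn; exact.
have fnle n x : D x -> (`|fn n x| <= `|(f x)%:E|)%E.
  by move=> Dx; rewrite /fn patchE; case: ifPn => //= _; rewrite normr0 lee_fin.
have H := @dominated_convergence _ _ _ (@lebesgue_measure R) D mD
  fn (EFin \o f) (abse \o (EFin \o f)) mfn mf.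
have [|||_ _ h] := H.
- by apply: aeW => x; exact: fnf.
- exact: integrable_abse.
- by apply: aeW => x n; exact: fnle.
rewrite /Rintegral.
suff -> : (\int[lebesgue_measure]_(x in D) (f x)%:E = l%:E)%E by [].
apply: (cvg_unique _ h) => //.
apply: (@cvg_trans _ (EFin \o (fun n => F (b n) - F (a n)) @ \oo)); last first.
  by apply: cvg_EFin => //; exact: nearW.
apply: near_eq_cvg; apply: nearW => n /=.
rewrite /fn -integral_mkcondr setIidr//= (@FTC2_is_derive _ _ F)//.
by move=> x; exact: cf.
Qed.

(** * The Gamma function *)

Lemma is_derive_continuous (R : realType) (f : R -> R) (x d : R) :
  is_derive x 1 f d -> {for x, continuous f}.
Proof.
move=> dfx; apply: differentiable_continuous.
exact/derivable1_diffP/ex_derive.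
Qed.

Lemma is_derive_cstD (R : realType) (c x : R) :
  is_derive x 1 (fun t => c + t) 1.
Proof. by apply: is_derive_eq; rewrite add0r ?mulr1. Qed.

Lemma is_derive_cstB (R : realType) (c x : R) :
  is_derive x 1 (fun t => c - t) (- 1).
Proof. by apply: is_derive_eq; rewrite add0r ?mul1r. Qed.

Lemma powR_continuous (R : realType) (a x : R) : 0 < x ->
  {for x, continuous (@powR R ^~ a)}.
Proof. by move=> x0; exact/is_derive_continuous/is_derive1_powR. Qed.

Lemma is_derive_powR (R : realType) (g : R -> R) (x d a : R) : 0 < g x ->
  is_derive x 1 g d ->
  is_derive x 1 (fun t => g t `^ a) (a * g x `^ (a - 1) * d).
Proof. by move=> gx dg; exact: (is_derive1_comp (is_derive1_powR a gx)). Qed.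

Lemma expR_powR (R : realType) (x y : R) : expR x `^ y = expR (x * y).
Proof. by rewrite /powR gt_eqF ?expR_gt0// expRK mulrC. Qed.

(** With u = (1 + t) / y, raise u <= 1 + u <= exp u to the power y and multiply by y^y. This lets
    powers of 1 + t control exp (- t). *)
Lemma powR1D_le_expR (R : realType) (y t : R) : 0 < y -> 0 <= t ->
  (1 + t) `^ y <= y `^ y * expR (1 + t).
Proof.
move=> y0 t0.
have {1}-> : 1 + t = y * ((1 + t) / y) by rewrite mulrCA divff ?mulr1// gt_eqF.
have ty0 : 0 <= (1 + t) / y by rewrite divr_ge0 ?ltW// ltr_wpDr.
rewrite powRM ?(ltW y0)// ler_wpM2l ?powR_ge0//.
have -> : expR (1 + t) = expR ((1 + t) / y) `^ y.
  by rewrite expR_powR divfK// gt_eqF.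
apply: ge0_ler_powR; rewrite ?nnegrE ?expR_ge0 ?(ltW y0)//.
by rewrite (le_trans _ (expR_ge1Dx _))// lerDr.
Qed.

(** Any n above x + 1/x bounds both x and 1/x. The shift to n + 2 keeps every segment nondegenerate:
    with n + 1 the first one would be the point 1. *)
Lemma itv0y_bigcup (R : realType) :
  `]0 : R, +oo[%classic = \bigcup_n `[n.+2%:R^-1, n.+2%:R]%classic.
Proof.
apply/seteqP; split=> x /=; rewrite in_itv/= ?andbT.
  move=> x0; have xV0 : 0 < x^-1 by rewrite invr_gt0.
  pose n := Num.Def.archi_bound (x + x^-1).
  have xn : x + x^-1 < n%:R.
    by rewrite archi_boundP// addr_ge0 ?ltW.
  exists n => //=; rewrite in_itv/=.
  have n2 : n%:R <= n.+2%:R :> R by rewrite ler_nat -addn2 leq_addr.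
  apply/andP; split; last first.
    by rewrite (le_trans _ n2)// (le_trans _ (ltW xn))// lerDl ltW.
  rewrite -[leRHS]invrK lef_pV2 ?posrE ?ltr0n// (le_trans _ n2)//.
  by rewrite (le_trans _ (ltW xn))// lerDr ltW.
case=> n _ /=; rewrite in_itv/= => /andP[+ _]; apply: lt_le_trans.
by rewrite invr_gt0 ltr0n.
Qed.

Lemma nonincreasing_invn (R : realType) :
  nonincreasing_seq (fun n => n.+2%:R^-1 : R).
Proof. by move=> i j ij; rewrite lef_pV2 ?posrE ?ltr0n// ler_nat !ltnS. Qed.

Lemma nondecreasing_natSS (R : realType) :
  nondecreasing_seq (fun n => n.+2%:R : R).
Proof. by move=> i j ij; rewrite ler_nat !ltnS. Qed.

Lemma invn_lt_natSS (R : realType) n : (n.+2%:R^-1 : R) < n.+2%:R.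
Proof.
apply: (@lt_trans _ _ 1); last by rewrite ltr1n.
by rewrite invf_lt1 ?ltr0n// ltr1n.
Qed.

(* [(t / (1 + t)) `^ x] is a bounded primitive of a function that dominates
   [t `^ (x - 1) * expR (- t)] at 0 and at +oo alike. *)
Lemma is_derive_gamma_majorant (R : realType) (x t : R) : 0 < t ->
  is_derive t 1 (fun t => (t / (1 + t)) `^ x)
    (x * (t `^ (x - 1) * (1 + t) `^ (- (x + 1)))).
Proof.
move=> t0; have t1 : 0 < 1 + t by rewrite addr_gt0.
have tt : 0 < t / (1 + t) by rewrite divr_gt0.
have d1 : is_derive t 1 (fun t : R => t / (1 + t)) ((1 + t) ^- 2).
  have t1N : (1 + t) != 0 by rewrite gt_eqF.
  apply: is_derive_eq.
  rewrite /GRing.scale/=; field.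
  exact: t1N.
have t0N : t != 0 by rewrite gt_eqF.
have t1N : (1 + t) != 0 by rewrite gt_eqF.
apply: is_derive_eq (@is_derive_powR _ (fun t => t / (1 + t)) _ _ x tt d1) _.
rewrite powRM ?invr_ge0 ?(ltW t0) ?(ltW t1)//.
rewrite -(powR_inv1 (ltW t1)) -powRrM !mulN1r -(powR_invn 2 (ltW t1)).
rewrite (_ : - (x + 1) = - (x - 1) + - 2); last by ring.
rewrite (@powRD _ (1 + t)); last by rewrite t1N implybT.
by ring.
Qed.

Lemma measurable_gamma_integrand (R : realType) (x : R) :
  measurable_fun `]0 : R, +oo[ (fun t => t `^ (x - 1) * expR (- t)).
Proof.
by apply: measurable_funM; apply: measurable_funTS => //; exact: measurableT_comp.
Qed.

Lemma continuous_gamma_integrand (R : realType) (x t : R) : 0 < t ->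
  {for t, continuous (fun t : R => t `^ (x - 1) * expR (- t))}.
Proof.
move=> t0; apply: (@continuousM _ _ (fun t => t `^ (x - 1)) (fun t => expR (- t))).
  exact: powR_continuous.
apply: continuous_comp; first exact: continuousN.
exact: continuous_expR.
Qed.

Lemma continuous_gamma_majorant (R : realType) (x t : R) : 0 < t ->
  {for t, continuous
     (fun t : R => x * (t `^ (x - 1) * (1 + t) `^ (- (x + 1))))}.
Proof.
move=> t0.
apply: (@continuousM _ _ (cst x)
  (fun t => t `^ (x - 1) * (1 + t) `^ (- (x + 1)))); first exact: cst_continuous.
apply: (@continuousM _ _ (fun t => t `^ (x - 1))
  (fun t => (1 + t) `^ (- (x + 1)))); first exact: powR_continuous.
apply: is_derive_continuous (@is_derive_powR _ (fun t => 1 + t) _ 1 _ _ _).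
  by rewrite addr_gt0.
exact: is_derive_cstD.
Qed.

Lemma integrable_EFinZl (R : realType) (D : set R) (r : R) (f : R -> R) :
  measurable D -> lebesgue_measure.-integrable D (EFin \o f) ->
  lebesgue_measure.-integrable D (EFin \o (fun x => r * f x)).
Proof.
move=> mD fi.
have : lebesgue_measure.-integrable D (fun x => r%:E * (f x)%:E)%E.
  exact: integrableZl.
exact.
Qed.

Lemma integrable_EFinB (R : realType) (D : set R) (f g : R -> R) :
  measurable D -> lebesgue_measure.-integrable D (EFin \o f) ->
  lebesgue_measure.-integrable D (EFin \o g) ->
  lebesgue_measure.-integrable D (EFin \o (fun x => f x - g x)).
Proof.
move=> mD fi gi.
have : lebesgue_measure.-integrable D (fun x => (f x)%:E - (g x)%:E)%E.
  exact: integrableB.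
exact.
Qed.

Lemma integrable_gamma (R : realType) (x : R) : 0 < x ->
  lebesgue_measure.-integrable `]0 : R, +oo[
    (EFin \o (fun t => t `^ (x - 1) * expR (- t))).
Proof.
move=> x0; have x1 : 0 < x + 1 by rewrite addr_gt0.
pose h (t : R) := x * (t `^ (x - 1) * (1 + t) `^ (- (x + 1))).
(* The factor 1/x cancels the x of h; the rest is the constant of [powR1D_le_expR] for the exponent
   x + 1, since (1 + t)^(x+1) <= (x+1)^(x+1) e exp t. *)
pose C := x^-1 * (x + 1) `^ (x + 1) * expR 1.
have C0 : 0 <= C.
  by rewrite !mulr_ge0 ?invr_ge0 ?powR_ge0 ?expR_ge0// ltW.
have gt0 n (t : R) : n.+2%:R^-1 <= t <= n.+2%:R -> 0 < t.
  by move=> /andP[+ _]; apply: lt_le_trans; rewrite invr_gt0 ltr0n.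
have ih : lebesgue_measure.-integrable `]0 : R, +oo[ (EFin \o h).
  rewrite itv0y_bigcup.
  apply: (@ge0_integrable_bigcup_itv _ _ _ h (fun t => (t / (1 + t)) `^ x) 1).
  - exact: invn_lt_natSS.
  - exact: nonincreasing_invn.
  - exact: nondecreasing_natSS.
  - by move=> n t /gt0 t0; rewrite /h !mulr_ge0 ?powR_ge0 ?(ltW x0).
  - by move=> n t /gt0; exact: continuous_gamma_majorant.
  - by move=> n t /gt0; exact: is_derive_gamma_majorant.
  - move=> n; rewrite lerBlDr ler_wpDr ?powR_ge0//.
    rewrite -[leRHS](congr1 (fun f => f x) (powR1 R)).
    have n0 : 0 < 1 + n.+2%:R :> R by rewrite addr_gt0// ltr0n.
    apply: ge0_ler_powR; rewrite ?nnegrE ?(ltW x0) ?divr_ge0 ?(ltW n0)//.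
    by rewrite ler_pdivrMr// mul1r lerDr.
have iCh : lebesgue_measure.-integrable `]0 : R, +oo[
    (EFin \o (fun t => C * h t)) by exact: integrable_EFinZl.
apply: le_integrable iCh => //.
  by apply/measurable_EFinP; exact (@measurable_gamma_integrand R x).
move=> t; rewrite /= in_itv/= andbT => t0; rewrite lee_fin.
have t10 : 0 < 1 + t by rewrite addr_gt0.
rewrite ger0_norm ?mulr_ge0 ?powR_ge0 ?expR_ge0//.
rewrite ger0_norm; last by rewrite mulr_ge0// /h !mulr_ge0 ?powR_ge0 ?(ltW x0).
have -> : C * h t = t `^ (x - 1) *
    ((x + 1) `^ (x + 1) * expR 1 * (1 + t) `^ (- (x + 1))).
  by rewrite /C /h; field; rewrite gt_eqF.
rewrite ler_wpM2l ?powR_ge0// powRN ler_pdivlMr ?powR_gt0//.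
rewrite expRN ler_pdivrMl ?expR_gt0//.
rewrite (le_trans (powR1D_le_expR x1 (ltW t0)))// expRD.
by rewrite le_eqVlt; apply/orP; left; apply/eqP; ring.
Qed.

Lemma cvg_invn (R : realType) : (n.+2%:R^-1 : R) @[n --> \oo] --> (0 : R).
Proof.
have := @cvg_harmonic R; rewrite -cvg_shiftS.
exact.
Qed.

Lemma cvg_powR_invn (R : realType) (x : R) : 0 < x ->
  (n.+2%:R^-1 `^ x : R) @[n --> \oo] --> (0 : R).
Proof.
move=> /powR_cvg0/cvg_at_rightP; apply; split; last exact: cvg_invn.
by move=> n; rewrite invr_gt0 ltr0n.
Qed.

(** A zero integral would make the nonnegative f vanish almost everywhere on D, so D would lie in a
    null set. *)
Lemma Rintegral_gt0 (R : realType) (D : set R) (f : R -> R) :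
  measurable D -> (0 < lebesgue_measure D)%E ->
  lebesgue_measure.-integrable D (EFin \o f) ->
  (forall x, D x -> 0 < f x) ->
  0 < \int[lebesgue_measure]_(x in D) f x.
Proof.
move=> mD D0 fi f0; rewrite lt_neqAle Rintegral_ge0 ?andbT; last first.
  by move=> x /f0/ltW.
apply/negP => /eqP int0.
have abs0 : (\int[lebesgue_measure]_(x in D) `|(EFin \o f) x| = 0)%E.
  have -> : (\int[lebesgue_measure]_(x in D) `|(EFin \o f) x| =
      \int[lebesgue_measure]_(x in D) (f x)%:E)%E.
    by apply: eq_integral => x; rewrite inE => /f0/ltW fx /=; rewrite ger0_norm.
  rewrite -[LHS]fineK; last exact: integrable_fin_num.
  by rewrite -/(Rintegral _ _ _) -int0.
have [N [mN N0 DN]] : ae_eq lebesgue_measure D (EFin \o f) (cst 0%E).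
  by apply/ae_eq_integral_abs => //; exact: measurable_int fi.
have : (lebesgue_measure D <= lebesgue_measure N)%E.
  apply: le_measure; rewrite ?inE// => x Dx; apply: DN => /= /(_ Dx) [fx0].
  by have := f0 _ Dx; rewrite fx0 ltxx.
by rewrite N0 leNgt D0.
Qed.

Lemma Gamma_gt0 (R : realType) (x : R) : 0 < x -> 0 < Gamma x.
Proof.
move=> x0; apply: Rintegral_gt0 => //.
- by rewrite lebesgue_measure_itv/= ?ltry.
- exact: integrable_gamma.
- by move=> t; rewrite /= in_itv/= andbT => t0; rewrite mulr_gt0 ?powR_gt0 ?expR_gt0.
Qed.

(** [powR1D_le_expR] with exponent x + 1 gives t^(x+1) <= C exp t, hence t^x exp (- t) <= C / t. *)
Lemma cvg_gamma_boundary (R : realType) (x : R) : 0 < x ->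
  (n.+2%:R `^ x * expR (- n.+2%:R) : R) @[n --> \oo] --> (0 : R).
Proof.
move=> x0; have x1 : 0 < x + 1 by rewrite addr_gt0.
pose C := (x + 1) `^ (x + 1) * expR 1.
apply: (@squeeze_cvgr _ _ _ _ (cst 0) (fun n => C * n.+2%:R^-1)).
- apply: nearW => n; set t : R := n.+2%:R.
  have t0 : 0 < t by rewrite ltr0n.
  rewrite mulr_ge0 ?powR_ge0 ?expR_ge0//= expRN ler_pdivlMr//.
  rewrite mulrAC ler_pdivrMr ?expR_gt0// /C -mulrA -expRD.
  apply: le_trans (powR1D_le_expR x1 (ltW t0)).
  rewrite -[X in _ * X]powRr1 ?(ltW t0)// -powRD; last by rewrite gt_eqF// implybT.
  apply: ge0_ler_powR.
  + exact: ltW.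
  + by rewrite nnegrE ltW.
  + by rewrite nnegrE addr_ge0// ltW.
  + by rewrite lerDr.
- exact: cvg_cst.
- by rewrite -[X in _ --> X](mulr0 C); apply: cvgM; [exact: cvg_cst|exact: cvg_invn].
Qed.

(** Integration by parts in one piece: x Gamma x - Gamma (x + 1) is the integral of the derivative
    of t^x exp (- t), which tends to 0 at both ends. *)
Lemma GammaD1 (R : realType) (x : R) : 0 < x -> Gamma (x + 1) = x * Gamma x.
Proof.
move=> x0; have x1 : 0 < x + 1 by rewrite addr_gt0.
apply/eqP; rewrite eq_sym -subr_eq0; apply/eqP.
have i0 := integrable_gamma x0; have i1 := integrable_gamma x1.
have ix0 : lebesgue_measure.-integrable `]0 : R, +oo[
    (EFin \o (fun t => x * (t `^ (x - 1) * expR (- t)))).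
  exact: integrable_EFinZl.
rewrite /Gamma -RintegralZl// -RintegralB// itv0y_bigcup.
have gt0 n (t : R) : n.+2%:R^-1 <= t <= n.+2%:R -> 0 < t.
  by move=> /andP[+ _]; apply: lt_le_trans; rewrite invr_gt0 ltr0n.
have dF n (t : R) : n.+2%:R^-1 <= t <= n.+2%:R ->
    is_derive t 1 (fun t : R => t `^ x * expR (- t))
      (x * (t `^ (x - 1) * expR (- t)) - t `^ (x + 1 - 1) * expR (- t)).
  move=> /gt0 t0; have d1 := is_derive1_powR x t0.
  have d2 : is_derive t 1 (fun t : R => expR (- t)) (- expR (- t)).
    by apply: is_derive_eq; rewrite mulrN1.
  apply: is_derive_eq (is_deriveM d1 d2) _.
  rewrite /GRing.scale/= addrK; ring.
apply: (@Rintegral_bigcup_itv _ _ _ _ (fun t => t `^ x * expR (- t))) => //.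
- exact: invn_lt_natSS.
- exact: nonincreasing_invn.
- exact: nondecreasing_natSS.
- move=> n t /gt0 t0; apply: continuousB.
    apply: continuousM; first exact: cst_continuous.
    exact: continuous_gamma_integrand.
  exact: continuous_gamma_integrand.
- by rewrite -itv0y_bigcup; exact: integrable_EFinB.
- rewrite -[X in _ --> X](subrr 0); apply: cvgB; first exact: cvg_gamma_boundary.
  apply: (@squeeze_cvgr _ _ _ _ (cst 0) (fun n => n.+2%:R^-1 `^ x)).
  + apply: nearW => n; rewrite mulr_ge0 ?powR_ge0 ?expR_ge0//=.
    by rewrite ler_piMr ?powR_ge0// expR_le1 oppr_le0 invr_ge0.
  + exact: cvg_cst.
  + exact: cvg_powR_invn.
Qed.

(** * Integrals of Legendre type *)

(** The distances 1 + x and 1 - x to the two ends are positive, so [itv0y_bigcup] bounds each from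
    below; the larger index serves both. *)
Lemma itvN11_bigcup (R : realType) :
  `]-1 : R, 1[%classic =
  \bigcup_n `[- 1 + n.+2%:R^-1, 1 - n.+2%:R^-1]%classic.
Proof.
apply/seteqP; split=> x /=; rewrite in_itv/=; last first.
  have n0 n : 0 < n.+2%:R^-1 :> R by rewrite invr_gt0 ltr0n.
  case=> n _ /=; rewrite in_itv/=; move: (n.+2%:R^-1) (n0 n) => e e0.
  by move=> /andP[? ?]; lra.
move=> /andP[x0 x1].
have xD : 0 < 1 + x by lra.
have xB : 0 < 1 - x by lra.
have : `]0 : R, +oo[%classic (1 + x) by rewrite /= in_itv/= andbT.
rewrite itv0y_bigcup => -[n _] /=; rewrite in_itv/= => /andP[nx _].
have : `]0 : R, +oo[%classic (1 - x) by rewrite /= in_itv/= andbT.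
rewrite itv0y_bigcup => -[m _] /=; rewrite in_itv/= => /andP[mx _].
exists (maxn n m) => //=; rewrite in_itv/=.
have := nonincreasing_invn R (leq_maxl n m).
have := nonincreasing_invn R (leq_maxr n m).
rewrite /=; move: (_^-1) (m.+2%:R^-1) (n.+2%:R^-1) mx nx => a b c ? ? ? ?; lra.
Qed.

Lemma measurable_legendre_kernel (R : realType) (D : set R) (k p t : R) :
  measurable D ->
  measurable_fun D (fun s : R => (1 - s ^+ 2) `^ k / (t - s) `^ p).
Proof.
move=> mD; under eq_fun do rewrite -powRN.
apply: measurable_funTS; apply: measurable_funM.
  apply: (measurableT_comp (measurable_powR k)).
  by apply: measurable_funB => //; exact: measurable_funX.
apply: (measurableT_comp (measurable_powR (- p))).
by apply: measurable_funB.
Qed.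

Lemma N11_invn (R : realType) n : - 1 + n.+2%:R^-1 < 1 - n.+2%:R^-1 :> R.
Proof.
have : n.+2%:R^-1 < 1 :> R by rewrite invf_lt1 ?ltr0n// ltr1n.
by move: (_^-1) => e; lra.
Qed.

Lemma onemX2_gt0 (R : realType) (s : R) : -1 < s < 1 -> 0 < 1 - s ^+ 2.
Proof.
move=> /andP[s0 s1]; have -> : 1 - s ^+ 2 = (1 + s) * (1 - s) by ring.
by rewrite mulr_gt0//; lra.
Qed.

(* For [k < 0] the singularities at -1 and 1 are split apart. *)
Lemma powR_onemX2_le (R : realType) (k s : R) : -1 < s < 1 ->
  (1 - s ^+ 2) `^ k <= 1 + ((1 + s) `^ k + (1 - s) `^ k).
Proof.
move=> /andP[s0 s1].
have ps : 0 < 1 + s by lra.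
have ms : 0 < 1 - s by lra.
have -> : 1 - s ^+ 2 = (1 + s) * (1 - s) by ring.
have [k0|k0] := leP 0 k.
  rewrite -[leLHS]addr0 lerD ?addr_ge0 ?powR_ge0//.
  rewrite -[leRHS](congr1 (fun f => f k) (powR1 R)).
  apply: ge0_ler_powR => //; [by rewrite nnegrE mulr_ge0// ltW|by rewrite nnegrE|].
  have -> : (1 + s) * (1 - s) = 1 - s ^+ 2 by ring.
  by rewrite gerBl sqr_ge0.
rewrite powRM ?(ltW ps) ?(ltW ms)//.
have le1 (x : R) : 1 <= x -> x `^ k <= 1.
  by move=> x1; rewrite -[leRHS](powRr0 x) ler_powR// ltW.
have [s00|s00] := leP 0 s.
  apply: (@le_trans _ _ ((1 - s) `^ k)).
    by rewrite ler_piMl ?powR_ge0// le1//; lra.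
  by rewrite addrA lerDr addr_ge0 ?powR_ge0.
apply: (@le_trans _ _ ((1 + s) `^ k)).
  by rewrite ler_piMr ?powR_ge0// le1//; lra.
by rewrite addrCA lerDl addr_ge0 ?powR_ge0.
Qed.

(** As k + 1 > 0, this primitive stays bounded on ]-1, 1[ even when k < 0 and its derivative blows
    up at the ends. *)
Lemma is_derive_onemX2_majorant (R : realType) (k s : R) : - 1 < k ->
  -1 < s < 1 ->
  is_derive s 1
    (fun s => s + (k + 1)^-1 * ((1 + s) `^ (k + 1) - (1 - s) `^ (k + 1)))
    (1 + ((1 + s) `^ k + (1 - s) `^ k)).
Proof.
move=> k1 /andP[s0 s1].
have ps : 0 < 1 + s by lra.
have ms : 0 < 1 - s by lra.
have d1 := is_derive_cstD 1 s.
have d2 := is_derive_cstB 1 s.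
have D1 := @is_derive_powR _ (fun s => 1 + s) _ _ (k + 1) ps d1.
have D2 := @is_derive_powR _ (fun s => 1 - s) _ _ (k + 1) ms d2.
have k0 : k + 1 != 0 by rewrite gt_eqF//; lra.
apply: (is_derive_eq (is_deriveD (is_derive_id s 1)
  (is_deriveZ (k + 1)^-1 (is_deriveB D1 D2)))).
by rewrite /GRing.scale/= !addrK; field.
Qed.

Lemma continuous_onemX2_majorant (R : realType) (k s : R) : -1 < s < 1 ->
  {for s, continuous (fun s : R => 1 + ((1 + s) `^ k + (1 - s) `^ k))}.
Proof.
move=> /andP[s0 s1].
have ps : 0 < 1 + s by lra.
have ms : 0 < 1 - s by lra.
have d1 := is_derive_cstD 1 s.
have d2 := is_derive_cstB 1 s.
apply: continuousD; first exact: cst_continuous.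
apply: continuousD; apply: is_derive_continuous.
  exact: (@is_derive_powR _ (fun s => 1 + s) _ _ k ps d1).
exact: (@is_derive_powR _ (fun s => 1 - s) _ _ k ms d2).
Qed.

Lemma itvN11_invn (R : realType) n (s : R) :
  - 1 + n.+2%:R^-1 <= s <= 1 - n.+2%:R^-1 -> -1 < s < 1.
Proof.
have : 0 < n.+2%:R^-1 :> R by rewrite invr_gt0 ltr0n.
by move: (_^-1) => e e0 /andP[? ?]; apply/andP; split; lra.
Qed.

Lemma nonincreasing_N1Dinvn (R : realType) :
  nonincreasing_seq (fun n => - 1 + n.+2%:R^-1 : R).
Proof. by move=> i j /(nonincreasing_invn R); rewrite lerD2l. Qed.

Lemma nondecreasing_1Binvn (R : realType) :
  nondecreasing_seq (fun n => 1 - n.+2%:R^-1 : R).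
Proof. by move=> i j /(nonincreasing_invn R); rewrite lerD2l lerN2. Qed.

Lemma integrable_onemX2 (R : realType) (k : R) : - 1 < k ->
  lebesgue_measure.-integrable `]-1 : R, 1[
    (EFin \o (fun s => (1 - s ^+ 2) `^ k)).
Proof.
move=> k1; have k0 : 0 < k + 1 by lra.
pose h (s : R) := 1 + ((1 + s) `^ k + (1 - s) `^ k).
pose H (s : R) := s + (k + 1)^-1 * ((1 + s) `^ (k + 1) - (1 - s) `^ (k + 1)).
have ih : lebesgue_measure.-integrable `]-1 : R, 1[ (EFin \o h).
  rewrite itvN11_bigcup.
  (* Both powers in H lie between 0 and 2^(k+1), hence so does the absolute value of their
     difference. *)
  have HM (s : R) : -1 < s < 1 -> `|H s| <= 1 + (k + 1)^-1 * 2 `^ (k + 1).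
    move=> /andP[s0 s1].
    rewrite (le_trans (ler_normD _ _))// lerD//; first by rewrite ler_norml; lra.
    rewrite normrM gtr0_norm ?invr_gt0// ler_wpM2l ?invr_ge0 ?(ltW k0)//.
    have b1 (x : R) : 0 <= x <= 2 -> 0 <= x `^ (k + 1) <= 2 `^ (k + 1).
      move=> /andP[x0 x2]; rewrite powR_ge0/=.
      by apply: ge0_ler_powR; rewrite ?nnegrE ?(ltW k0).
    have /b1/andP[p0 p1] : 0 <= 1 + s <= 2 by apply/andP; split; lra.
    have /b1/andP[q0 q1] : 0 <= 1 - s <= 2 by apply/andP; split; lra.
    by rewrite ler_norml; apply/andP; split; lra.
  apply: (@ge0_integrable_bigcup_itv _ _ _ h H
    (2 * (1 + (k + 1)^-1 * 2 `^ (k + 1)))).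
  - exact: N11_invn.
  - exact: nonincreasing_N1Dinvn.
  - exact: nondecreasing_1Binvn.
  - by move=> n s _; rewrite /h !addr_ge0 ?powR_ge0.
  - by move=> n s /itvN11_invn; exact: continuous_onemX2_majorant.
  - by move=> n s /itvN11_invn; exact: is_derive_onemX2_majorant.
  - move=> n; rewrite (le_trans (ler_norm _))// (le_trans (ler_normB _ _))//.
    rewrite mulr_natl mulr2n lerD// HM//; apply: (@itvN11_invn _ n).
      by rewrite lexx andbT ltW// N11_invn.
    by rewrite lexx/= ltW// N11_invn.
apply: le_integrable ih => //.
  apply/measurable_EFinP; apply: measurable_funTS.
  apply: (measurableT_comp (measurable_powR k)).
  by apply: measurable_funB => //; exact: measurable_funX.
move=> s; rewrite /= in_itv/= => s1; rewrite lee_fin.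
rewrite ger0_norm ?powR_ge0// ger0_norm ?powR_onemX2_le//.
by rewrite /h !addr_ge0 ?powR_ge0.
Qed.

(** The endpoints form a null set, so integrability is proved on the open interval, away from the
    singularities, and carried to the closed one. *)
Lemma integrable_itv_bndoo (R : realType) (x y : R) (f : R -> R) (b0 b1 : bool) :
  measurable_fun setT f ->
  lebesgue_measure.-integrable `]x, y[ (EFin \o f) ->
  lebesgue_measure.-integrable [set` Interval (BSide b0 x) (BSide b1 y)]
    (EFin \o f).
Proof.
move=> mf fi; apply/integrableP; split.
  by apply/measurable_EFinP; exact: measurable_funTS.
rewrite integral_itv_bndoo; first by case/integrableP : fi.
apply: measurableT_comp => //; apply/measurable_EFinP.
exact: measurable_funTS.
Qed.

(** On [-1, 1] one has t - s >= t - 1 > 0, so the denominator costs at most the constant factor (t -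
    1)^(-p). *)
Lemma integrable_legendre_kernel (R : realType) (k p t : R) (D : set R) :
  -1 < k -> 0 <= p -> 1 < t -> measurable D -> D `<=` `[-1, 1] ->
  lebesgue_measure.-integrable D
    (EFin \o (fun s => (1 - s ^+ 2) `^ k / (t - s) `^ p)).
Proof.
move=> k1 p0 t1 mD sD.
have iw : lebesgue_measure.-integrable `[-1 : R, 1]
    (EFin \o (fun s => (1 - s ^+ 2) `^ k)).
  apply: integrable_itv_bndoo (integrable_onemX2 k1).
  apply: (measurableT_comp (measurable_powR k)).
  by apply: measurable_funB => //; exact: measurable_funX.
have iwD : lebesgue_measure.-integrable D
    (EFin \o (fun s => ((t - 1) `^ p)^-1 * (1 - s ^+ 2) `^ k)).
  by apply: integrable_EFinZl => //; apply: integrableS iw.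
apply: le_integrable iwD => //.
  by apply/measurable_EFinP; exact: measurable_legendre_kernel.
move=> s /sD; rewrite /= in_itv/= => /andP[s0 s1]; rewrite lee_fin.
rewrite !ger0_norm ?mulr_ge0 ?invr_ge0 ?powR_ge0// mulrC ler_wpM2r ?powR_ge0//.
have ts : 0 < t - s by lra.
have t10 : 0 < t - 1 by lra.
rewrite lef_pV2 ?posrE ?powR_gt0//.
by apply: ge0_ler_powR; rewrite ?nnegrE ?(ltW ts) ?(ltW t10)//; lra.
Qed.

(** The integral J_{k,p}. The exponents are independent parameters because differentiation in t
    raises p alone, while passing from Q_k^m to Q_{k+1}^m raises both. *)
Definition legendre_int (R : realType) (k p t : R) : R :=
  \int[lebesgue_measure]_(s in `[-1, 1]) ((1 - s ^+ 2) `^ k / (t - s) `^ p).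

Lemma legendre_int_oo (R : realType) (k p t : R) :
  legendre_int k p t =
  \int[lebesgue_measure]_(s in `]-1, 1[) ((1 - s ^+ 2) `^ k / (t - s) `^ p).
Proof.
rewrite /legendre_int /Rintegral integral_itv_bndoo//.
apply: measurableT_comp => //.
exact: (@measurable_legendre_kernel _ _ k p t (measurable_itv _)).
Qed.

(** The open interval is used because the kernel is positive there, whereas at -1 and 1 it is 0 for
    k different from 0. *)
Lemma legendre_int_gt0 (R : realType) (k p t : R) : -1 < k -> 0 <= p -> 1 < t ->
  0 < legendre_int k p t.
Proof.
move=> k1 p0 t1; rewrite legendre_int_oo; apply: Rintegral_gt0 => //.
- have N11 : -1 < 1 :> R by lra.
  by rewrite lebesgue_measure_itv/= lte_fin N11 -EFinB lte_fin; lra.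
- apply: integrable_legendre_kernel => //; exact: subset_itv_oo_cc.
- move=> s; rewrite /= in_itv/= => /[dup] s11 /andP[_ s1].
  by rewrite divr_gt0// powR_gt0 ?onemX2_gt0//; lra.
Qed.

Lemma is_derive_legendre_kernel (R : realType) (k p s t : R) : s < t ->
  is_derive t 1 (fun t => (1 - s ^+ 2) `^ k / (t - s) `^ p)
    (- p * ((1 - s ^+ 2) `^ k / (t - s) `^ (p + 1))).
Proof.
move=> st; have ts : 0 < t - s by rewrite subr_gt0.
have d1 : is_derive t 1 (fun t : R => t - s) 1.
  by apply: is_derive_eq; rewrite subr0.
have D := @is_derive_powR _ (fun t => t - s) _ _ (- p) ts d1.
under eq_fun do rewrite -powRN.
apply: is_derive_eq (is_deriveZ ((1 - s ^+ 2) `^ k) D) _.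
by rewrite /GRing.scale/= -powRN opprD; ring.
Qed.

Lemma is_derive_legendre_int (R : realType) (k p t : R) :
  -1 < k -> 0 <= p -> 1 < t ->
  is_derive t 1 (legendre_int k p) (- p * legendre_int k (p + 1) t).
Proof.
move=> k1 p0 t1.
pose f (t s : R) := (1 - s ^+ 2) `^ k / (t - s) `^ p.
(* The parameter x will range over [](1 + t) / 2, t + 1[], whose left end is the midpoint of 1 and
   t. There x - s > (t - 1) / 2 for every s in [-1, 1], so G dominates the derivative in x
   uniformly. *)
pose G (s : R) := p * (((t - 1) / 2) `^ (p + 1))^-1 * (1 - s ^+ 2) `^ k.
have It : `](1 + t) / 2, t + 1[%classic t.
  by rewrite /= in_itv/=; apply/andP; split; lra.
have I1 x : `](1 + t) / 2, t + 1[%classic x -> 1 + (t - 1) / 2 < x.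
  by rewrite /= in_itv/= => /andP[? ?]; lra.
have intf x : `](1 + t) / 2, t + 1[%classic x ->
    lebesgue_measure.-integrable `[-1, 1] (EFin \o f x).
  by move=> /I1 x1; apply: integrable_legendre_kernel => //; lra.
have lt1 x s : `](1 + t) / 2, t + 1[%classic x -> `[-1, 1]%classic s ->
    (t - 1) / 2 < x - s.
  by move=> /I1 x1; rewrite /= in_itv/= => /andP[? ?]; lra.
have df x s : `](1 + t) / 2, t + 1[%classic x -> `[-1, 1]%classic s ->
    is_derive x 1 (f ^~ s) (- p * ((1 - s ^+ 2) `^ k / (x - s) `^ (p + 1))).
  move=> xI sI; apply: is_derive_legendre_kernel.
  by have := lt1 _ _ xI sI; lra.
have derf x s : `](1 + t) / 2, t + 1[%classic x -> `[-1, 1]%classic s ->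
    derivable (f ^~ s) x 1.
  by move=> xI sI; have [] := df _ _ xI sI.
have d1f x s : `](1 + t) / 2, t + 1[%classic x -> `[-1, 1]%classic s ->
    partial1of2 f x s = - p * ((1 - s ^+ 2) `^ k / (x - s) `^ (p + 1)).
  by move=> xI sI; rewrite partial1of2E; have [] := df _ _ xI sI.
have G0 s : 0 <= G s by rewrite /G !mulr_ge0 ?invr_ge0 ?powR_ge0.
have iG : lebesgue_measure.-integrable `[-1, 1] (EFin \o G).
  apply: integrable_EFinZl => //.
  apply: integrable_itv_bndoo (integrable_onemX2 k1).
  apply: (measurableT_comp (measurable_powR k)).
  by apply: measurable_funB => //; exact: measurable_funX.
have Gub x s : `](1 + t) / 2, t + 1[%classic x -> `[-1, 1]%classic s ->
    `|partial1of2 f x s| <= G s.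
  move=> xI sI; rewrite d1f// /G normrM normrN (ger0_norm p0).
  rewrite ger0_norm ?mulr_ge0 ?invr_ge0 ?powR_ge0// -mulrA ler_wpM2l//.
  rewrite mulrC ler_wpM2r ?powR_ge0//.
  have xs := lt1 _ _ xI sI.
  have t0 : 0 < (t - 1) / 2 by lra.
  rewrite lef_pV2 ?posrE ?powR_gt0 ?(lt_trans t0 xs)//.
  have xs0 := lt_trans t0 xs.
  by apply: ge0_ler_powR; rewrite ?nnegrE ?(ltW xs0) ?(ltW xs) ?(ltW t0)//; lra.
have mI : measurable `[-1 : R, 1]%classic by exact: measurable_itv.
have D1 := derivable_under_integral (mu := @lebesgue_measure R)
  mI It intf derf G0 iG Gub.
have D2 := differentiation_under_integral (mu := @lebesgue_measure R)
  mI It intf derf G0 iG Gub.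
split; first exact: D1.
rewrite -derive1E [LHS]D2 -RintegralZl//; last first.
  by apply: integrable_legendre_kernel => //; lra.
by apply: eq_Rintegral => s; rewrite inE => sI; rewrite d1f.
Qed.

Lemma is_derive_onemX2 (R : realType) (s : R) :
  is_derive s 1 (fun s => 1 - s ^+ 2) (- (2 * s)).
Proof. by apply: is_derive_eq; rewrite /GRing.scale/=; ring. Qed.

(** The product rule leaves an explicit factor s. It is eliminated by 1 - s^2 = (t + s) (t - s) -
    (t^2 - 1), after which only kernels of Legendre type remain, with coefficients free of s. *)
Lemma is_derive_legendre_boundary (R : realType) (k p t s : R) : -1 < k ->
  1 < t -> -1 < s < 1 ->
  is_derive s 1 (fun s => (1 - s ^+ 2) `^ (k + 1) * (t - s) `^ (- p))
    (2 * (k + 1) * t * ((1 - s ^+ 2) `^ k / (t - s) `^ p)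
     - 2 * (k + 1) * (t ^+ 2 - 1) * ((1 - s ^+ 2) `^ k / (t - s) `^ (p + 1))
     - (2 * k + 2 - p) * ((1 - s ^+ 2) `^ (k + 1) / (t - s) `^ (p + 1))).
Proof.
move=> k1 t1 s11; have /andP[s0 s1] := s11.
have w0 := onemX2_gt0 s11.
have ts : 0 < t - s by lra.
have dw := is_derive_onemX2 s.
have dt := is_derive_cstB t s.
have D1 := @is_derive_powR _ (fun s => 1 - s ^+ 2) _ _ (k + 1) w0 dw.
have D2 := @is_derive_powR _ (fun s => t - s) _ _ (- p) ts dt.
apply: is_derive_eq (is_deriveM D1 D2) _.
rewrite /GRing.scale/= addrK -!powRN.
have w0N : 1 - s ^+ 2 != 0 by rewrite gt_eqF.
have tsN : t - s != 0 by rewrite gt_eqF.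
have -> : (1 - s ^+ 2) `^ (k + 1) = (1 - s ^+ 2) `^ k * (1 - s ^+ 2).
  by rewrite powRD ?w0N ?implybT// powRr1// ltW.
have -> : (t - s) `^ (- p) = (t - s) `^ (- p - 1) * (t - s).
  by rewrite -[X in _ * X]powRr1 ?(ltW ts)// -powRD ?subrK// tsN implybT.
rewrite opprD; ring.
Qed.

(** At distance e from either end, 1 - s^2 = (2 - e) e, and t - s >= t - 1; the boundary term is
    thus of order e^(k+1) and vanishes in the limit. *)
Lemma legendre_boundary_le (R : realType) (k p t s e : R) : -1 < k -> 0 <= p ->
  1 < t -> 0 < e < 1 -> s = - 1 + e \/ s = 1 - e ->
  (1 - s ^+ 2) `^ (k + 1) * (t - s) `^ (- p)
  <= 2 `^ (k + 1) / (t - 1) `^ p * e `^ (k + 1).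
Proof.
move=> k1 p0 t1 /andP[e0 e1] se.
have k0 : 0 <= k + 1 by lra.
have -> : 1 - s ^+ 2 = (2 - e) * e by case: se => ->; ring.
have s1 : s <= 1 by case: se => ->; lra.
have ts : 0 < t - s by lra.
have t0 : 0 < t - 1 by lra.
rewrite mulrAC powRN -powRM ?(ltW e0)//.
apply: ler_pM; rewrite ?invr_ge0 ?powR_ge0//.
  have e2 : 0 <= 2 - e by lra.
  apply: ge0_ler_powR => //; rewrite ?nnegrE ?mulr_ge0 ?(ltW e0)//.
  by rewrite ler_wpM2r ?(ltW e0)//; lra.
rewrite lef_pV2 ?posrE ?powR_gt0//.
by apply: ge0_ler_powR; rewrite ?nnegrE ?(ltW ts) ?(ltW t0)//; lra.
Qed.

Lemma continuous_legendre_kernel (R : realType) (k p t s : R) : 1 < t ->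
  -1 < s < 1 ->
  {for s, continuous (fun s : R => (1 - s ^+ 2) `^ k / (t - s) `^ p)}.
Proof.
move=> t1 s11; have /andP[s0 s1] := s11.
have w0 := onemX2_gt0 s11.
have ts : 0 < t - s by lra.
have dw := is_derive_onemX2 s.
have dt := is_derive_cstB t s.
have -> : (fun s : R => (1 - s ^+ 2) `^ k / (t - s) `^ p) =
    (fun s : R => (1 - s ^+ 2) `^ k * (t - s) `^ (- p)).
  by apply/funext => x; rewrite powRN.
apply: continuousM; apply: is_derive_continuous.
  exact: (@is_derive_powR _ (fun s => 1 - s ^+ 2) _ _ k w0 dw).
exact: (@is_derive_powR _ (fun s => t - s) _ _ (- p) ts dt).
Qed.

(* The difference of the two sides is the integral of the derivative of
   [(1 - s ^+ 2) `^ (k + 1) / (t - s) `^ p], which vanishes at both ends. *)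
Lemma legendre_int_rec (R : realType) (k p t : R) :
  -1 < k -> 0 <= p -> 1 < t ->
  2 * (k + 1) * t * legendre_int k p t
  - 2 * (k + 1) * (t ^+ 2 - 1) * legendre_int k (p + 1) t
  = (2 * k + 2 - p) * legendre_int (k + 1) (p + 1) t.
Proof.
move=> k1 p0 t1; apply/eqP; rewrite -subr_eq0; apply/eqP.
have ik k' p' c : -1 < k' -> 0 <= p' ->
    lebesgue_measure.-integrable `]-1 : R, 1[
      (EFin \o (fun s => c * ((1 - s ^+ 2) `^ k' / (t - s) `^ p'))).
  move=> k'1 p'0; apply: integrable_EFinZl => //.
  by apply: integrable_legendre_kernel => //; exact: subset_itv_oo_cc.
have Jc k' p' c : -1 < k' -> 0 <= p' -> c * legendre_int k' p' t =
    \int[lebesgue_measure]_(s in `]-1, 1[)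
      (c * ((1 - s ^+ 2) `^ k' / (t - s) `^ p')).
  move=> k'1 p'0; rewrite legendre_int_oo RintegralZl//.
  by apply: integrable_legendre_kernel => //; exact: subset_itv_oo_cc.
have p1 : 0 <= p + 1 by lra.
have k2 : -1 < k + 1 by lra.
have i1 := ik k p (2 * (k + 1) * t) k1 p0.
have i2 := ik k (p + 1) (2 * (k + 1) * (t ^+ 2 - 1)) k1 p1.
have i3 := ik (k + 1) (p + 1) (2 * k + 2 - p) k2 p1.
have i12 := integrable_EFinB (measurable_itv _) i1 i2.
rewrite !Jc// -RintegralB// -RintegralB// itvN11_bigcup.
apply: (@Rintegral_bigcup_itv _ _ _ _
  (fun s => (1 - s ^+ 2) `^ (k + 1) * (t - s) `^ (- p))).
- exact: N11_invn.
- exact: nonincreasing_N1Dinvn.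
- exact: nondecreasing_1Binvn.
- move=> n s /itvN11_invn s1.
  by apply: continuousB; first apply: continuousB; (apply: continuousM;
    [exact: cst_continuous|exact: continuous_legendre_kernel]).
- by move=> n s /itvN11_invn; exact: is_derive_legendre_boundary.
- by rewrite -itvN11_bigcup; exact: integrable_EFinB.
- have bnd (u : nat -> R) :
      (forall n, u n = - 1 + n.+2%:R^-1 \/ u n = 1 - n.+2%:R^-1) ->
      (1 - u n ^+ 2) `^ (k + 1) * (t - u n) `^ (- p) @[n --> \oo] --> (0 : R).
    move=> hu.
    apply: (@squeeze_cvgr _ _ _ _ (cst 0)
      (fun n => 2 `^ (k + 1) / (t - 1) `^ p * n.+2%:R^-1 `^ (k + 1))).
    + apply: nearW => n; rewrite mulr_ge0 ?powR_ge0//=.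
      apply: legendre_boundary_le => //.
      by rewrite invr_gt0 ltr0n invf_lt1 ?ltr0n// ltr1n.
    + exact: cvg_cst.
    + rewrite -[X in _ --> X](mulr0 (2 `^ (k + 1) / (t - 1) `^ p)).
      by apply: cvgM; [exact: cvg_cst|apply: cvg_powR_invn; lra].
  rewrite -[X in _ --> X](subrr 0).
  by apply: cvgB; apply: bnd => n; [right|left].
Qed.

Lemma is_derive_mul (R : realType) (f g : R -> R) (x df dg : R) :
  is_derive x 1 f df -> is_derive x 1 g dg ->
  is_derive x 1 (fun t => f t * g t) (df * g x + f x * dg).
Proof.
move=> Df Dg; apply: is_derive_eq (is_deriveM Df Dg) _.
by rewrite addrC; congr (_ + _); exact: mulrC.
Qed.

(** * Legendre functions of the second kind *)

Definition legendre_coef (R : realType) (k : R) (m : nat) : R :=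
  (-1) ^+ m / 2 `^ (k + 1) * (Gamma (k + m%:R + 1) / Gamma (k + 1)).

Lemma legendreQE (R : realType) (k : R) (m : nat) (t : R) :
  legendreQ k m t = legendre_coef k m * (t ^+ 2 - 1) `^ (m%:R / 2)
                    * legendre_int k (k + m%:R + 1) t.
Proof. by []. Qed.

(** The functional equation acts on both Gamma factors and the power of 2 doubles. Both Q_k^m and
    Q_{k+1}^m can then be written with the constant [legendre_coef k m]. *)
Lemma legendre_coefD1 (R : realType) (k : R) (m : nat) : -1 < k ->
  legendre_coef (k + 1) m =
  legendre_coef k m * ((k + m%:R + 1) / (2 * (k + 1))).
Proof.
move=> k1; have k0 : 0 < k + 1 by lra.
have km0 : 0 < k + m%:R + 1 by rewrite addrAC ltr_wpDr.
rewrite /legendre_coef (addrAC k 1 m%:R) (GammaD1 km0) (GammaD1 k0).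
rewrite powRD; last by rewrite pnatr_eq0 implybT.
rewrite powRr1//; field.
by rewrite !gt_eqF ?powR_gt0 ?Gamma_gt0.
Qed.

Lemma legendreQ_neq0 (R : realType) (k : R) (m : nat) (t : R) :
  -1 < k -> 1 < t -> legendreQ k m t != 0.
Proof.
move=> k1 t1; have k0 : 0 < k + 1 by lra.
have km0 : 0 < k + m%:R + 1 by rewrite addrAC ltr_wpDr.
have t20 : 0 < t ^+ 2 - 1 by nra.
rewrite legendreQE /legendre_coef.
by rewrite !mulf_neq0 ?invr_neq0 ?expf_neq0 ?oppr_eq0 ?oner_eq0//
  gt_eqF ?powR_gt0 ?Gamma_gt0 ?legendre_int_gt0 ?(ltW km0).
Qed.

Lemma is_derive_legendreQ (R : realType) (k : R) (m : nat) (t : R) :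
  -1 < k -> 1 < t ->
  is_derive t 1 (legendreQ k m)
    (((k - m%:R + 1) * legendreQ (k + 1) m t - (k + 1) * t * legendreQ k m t)
     / (t ^+ 2 - 1)).
Proof.
move=> k1 t1; have k0 : 0 < k + 1 by lra.
set p := k + m%:R + 1.
have p0 : 0 < p by rewrite /p addrAC ltr_wpDr.
have t20 : 0 < t ^+ 2 - 1 by nra.
have dt : is_derive t 1 (fun t : R => t ^+ 2 - 1) (2 * t).
  by apply: is_derive_eq; rewrite /GRing.scale/=; ring.
have D1 := @is_derive_powR _ (fun t => t ^+ 2 - 1) _ _ (m%:R / 2) t20 dt.
have D2 := is_derive_legendre_int k1 (ltW p0) t1.
have D3 : is_derive t 1 (fun t => legendre_coef k m * (t ^+ 2 - 1) `^ (m%:R / 2))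
    (legendre_coef k m * (m%:R / 2 * (t ^+ 2 - 1) `^ (m%:R / 2 - 1) * (2 * t))).
  exact: is_deriveZ D1.
apply: is_derive_eq (is_derive_mul D3 D2) _.
have rec := legendre_int_rec k1 (ltW p0) t1.
rewrite !legendreQE legendre_coefD1// -/p.
rewrite (_ : k + 1 + m%:R + 1 = p + 1); last by rewrite /p; ring.
have -> : (t ^+ 2 - 1) `^ (m%:R / 2 - 1) =
    (t ^+ 2 - 1) `^ (m%:R / 2) / (t ^+ 2 - 1).
  rewrite powRB; last by rewrite lt0r_neq0 ?implybT.
  by rewrite powRr1 ?(ltW t20).
set c := legendre_coef k m; set P := _ `^ (m%:R / 2).
(* For p = k + m + 1 the factor 2k + 2 - p of [rec] is exactly k - m + 1, so [rec] trades the
   integral in Q_{k+1}^m for J_{k,p} and J_{k,p+1}. *)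
have -> : (k - m%:R + 1) * (c * (p / (2 * (k + 1))) * P *
      legendre_int (k + 1) (p + 1) t)
    = c * (p / (2 * (k + 1))) * P *
      ((2 * k + 2 - p) * legendre_int (k + 1) (p + 1) t).
  by rewrite /p; ring.
rewrite -rec.
move: (legendre_int k p t) (legendre_int k (p + 1) t) => X Y.
rewrite /p; field.
by rewrite !gt_eqF.
Qed.

(** * Toroidal coordinates *)

Lemma cosh2Bsinh2 (R : realType) (e : R) : cosh e ^+ 2 - sinh e ^+ 2 = 1.
Proof.
rewrite /cosh /sinh expRN; field.
by rewrite expR_eq0.
Qed.

Lemma sinh_gt0 (R : realType) (e : R) : 0 < e -> 0 < sinh e.
Proof.
by move=> e0; rewrite /sinh divr_gt0// subr_gt0 ltr_expR gtrN.
Qed.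

Lemma cosh_gt0 (R : realType) (e : R) : 0 < cosh e.
Proof. by rewrite /cosh divr_gt0// addr_gt0// expR_gt0. Qed.

Lemma cosh_gt1 (R : realType) (e : R) : 0 < e -> 1 < cosh e.
Proof.
move=> /sinh_gt0 s0; have := cosh2Bsinh2 e; have := cosh_gt0 e; nra.
Qed.

(** The witness is arcosh c = ln (c + r) with r = sqrt (c^2 - 1); the inverse of c + r is c - r. *)
Lemma cosh_surj (R : realType) (c : R) : 1 < c ->
  exists2 e, 0 < e & cosh e = c.
Proof.
move=> c1; set r := Num.sqrt (c ^+ 2 - 1).
have c20 : 0 <= c ^+ 2 - 1 by nra.
have r2 : r ^+ 2 = c ^+ 2 - 1 by rewrite sqr_sqrtr.
have r0 : 0 <= r by exact: sqrtr_ge0.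
have cr1 : 1 < c + r by lra.
have cr0 : 0 < c + r by lra.
exists (ln (c + r)); first by rewrite ln_gt0.
rewrite /cosh expRN lnK ?posrE//.
have -> : (c + r)^-1 = c - r.
  apply: (mulfI (lt0r_neq0 cr0)); rewrite divff ?lt0r_neq0//.
  have -> : (c + r) * (c - r) = c ^+ 2 - r ^+ 2 by ring.
  by rewrite r2; ring.
by field.
Qed.

Lemma polar_angle (R : realType) (c s : R) : c ^+ 2 + s ^+ 2 = 1 ->
  exists t, [/\ - pi < t <= pi, cos t = c & sin t = s].
Proof.
move=> cs1.
have cN11 : -1 <= c <= 1 by apply/andP; split; nra.
have cI : c \in `[-1, 1] by rewrite in_itv.
have pi0 := pi_gt0 R.
have ss : Num.sqrt (1 - c ^+ 2) = `|s| by rewrite -cs1 addrAC subrr add0r sqrtr_sqr.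
have [s0|s0] := leP 0 s.
  exists (acos c); split; last by rewrite sin_acos// ss ger0_norm.
    by rewrite acos_lepi// andbT (lt_le_trans _ (acos_ge0 cN11))// oppr_lt0.
  exact: acosK.
exists (- acos c); split; last by rewrite sinN sin_acos// ss ltr0_norm// opprK.
  (* The value -pi must be avoided: c = -1 would force s = 0, against s < 0. *)
  have cN1 : -1 < c <= 1.
    move/andP: cN11 => [cN1 ->]; rewrite andbT lt_neqAle cN1 andbT.
    apply/eqP => c1; move: cs1; rewrite -c1 => cs1.
    by have : 0 < s ^+ 2 by [rewrite lt_neqAle sqr_ge0 eq_sym sqrf_eq0 lt_eqF]; lra.
  rewrite ltrN2 acos_ltpi//=; have := acos_ge0 cN11; lra.
by rewrite cosN acosK.
Qed.

(** Real and imaginary parts of (c + i s)^n. Being polynomials in c and s, they remain smooth where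
    the angle itself jumps. *)
Fixpoint multiple_angle (R : realType) (n : nat) (c s : R) : R * R :=
  if n is n'.+1 then
    let p := multiple_angle n' c s in (p.1 * c - p.2 * s, p.2 * c + p.1 * s)
  else (1, 0).

Lemma multiple_angleE (R : realType) (n : nat) (t : R) :
  multiple_angle n (cos t) (sin t) = (cos (n%:R * t), sin (n%:R * t)).
Proof.
elim: n => [|n IHn] /=; first by rewrite mul0r cos0 sin0.
by rewrite IHn/= -natr1 mulrDl mul1r cosD sinD.
Qed.

Definition cart_Phi (R : realType) (nu : int) (n : nat) (c s : R) : R :=
  if nu == 1 then (multiple_angle n c s).1 else (multiple_angle n c s).2.

Lemma cart_PhiE (R : realType) (nu : int) (n : nat) (t : R) :
  cart_Phi nu n (cos t) (sin t) = Phi nu n%:Z t.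
Proof. by rewrite /cart_Phi multiple_angleE /Phi -pmulrn; case: ifP. Qed.

Definition crd0 : 'I_3 := @Ordinal 3 0 isT.
Definition crd1 : 'I_3 := @Ordinal 3 1 isT.
Definition crd2 : 'I_3 := @Ordinal 3 2 isT.

Definition axis_dist2 (R : realType) (x : 'rV[R]_3) : R :=
  x 0 crd1 ^+ 2 + x 0 crd2 ^+ 2.

Definition sq_normD1 (R : realType) (x : 'rV[R]_3) : R :=
  x 0 crd0 ^+ 2 + axis_dist2 x + 1.

(* The product of the squared largest and smallest distances from [x] to the
   circle S^1. *)
Definition circle_dist4 (R : realType) (x : 'rV[R]_3) : R :=
  sq_normD1 x ^+ 2 - 4 * axis_dist2 x.

Section toroidal_point.
Context {R : realType} (e th ph : R) (e0 : 0 < e).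
Let x := toroidal_point e th ph.
Let D := cosh e - cos th.

Lemma coshBcos_gt0 : 0 < D.
Proof. by rewrite subr_gt0 (le_lt_trans (cos_le1 _))// cosh_gt1. Qed.

Let DN : D != 0.
Proof. by rewrite lt0r_neq0// coshBcos_gt0. Qed.

Let x0E : x 0 crd0 = sin th / D. Proof. by rewrite mxE. Qed.
Let x1E : x 0 crd1 = sinh e * cos ph / D. Proof. by rewrite mxE. Qed.
Let x2E : x 0 crd2 = sinh e * sin ph / D. Proof. by rewrite mxE. Qed.

Lemma axis_dist2_toroidal : axis_dist2 x = (sinh e / D) ^+ 2.
Proof.
have cs := cos2Dsin2 ph.
rewrite /axis_dist2 x1E x2E.
transitivity ((sinh e / D) ^+ 2 * (cos ph ^+ 2 + sin ph ^+ 2)); first by field.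
by rewrite cs mulr1.
Qed.

(** Over the denominator D^2 the numerator is sin^2 th + sinh^2 e + D^2, which collapses to 2 cosh e
    D. *)
Lemma sq_normD1_toroidal : sq_normD1 x = 2 * cosh e / D.
Proof.
rewrite /sq_normD1 axis_dist2_toroidal x0E.
have s2 := sin2cos2 th.
have sh2 : sinh e ^+ 2 = cosh e ^+ 2 - 1 by rewrite -(cosh2Bsinh2 e); ring.
rewrite (expr_div_n (sin th)) (expr_div_n (sinh e)) s2 sh2 /D; field.
exact: DN.
Qed.

(** The numerator is 4 (cosh^2 e - sinh^2 e) = 4, so D is recovered from the point as 2 / sqrt
    (circle_dist4 x). *)
Lemma circle_dist4_toroidal : circle_dist4 x = (2 / D) ^+ 2.
Proof.
rewrite /circle_dist4 axis_dist2_toroidal sq_normD1_toroidal.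
have sh2 : sinh e ^+ 2 = cosh e ^+ 2 - 1 by rewrite -(cosh2Bsinh2 e); ring.
by rewrite (expr_div_n (sinh e)) sh2; field.
Qed.

Lemma axis_dist2_toroidal_gt0 : 0 < axis_dist2 x.
Proof.
by rewrite axis_dist2_toroidal exprn_gt0// divr_gt0 ?sinh_gt0 ?coshBcos_gt0.
Qed.

Lemma circle_dist4_toroidal_gt0 : 0 < circle_dist4 x.
Proof. by rewrite circle_dist4_toroidal exprn_gt0// divr_gt0 ?coshBcos_gt0. Qed.

End toroidal_point.

(** The inverse is explicit off the x_0-axis and off S^1: cosh eta = A / S has a solution because S
    < A, and the pairs ((A - 2) / S, 2 x_0 / S) and (x_1 / r, x_2 / r) lie on the unit circle, which
    yields theta and phi. *)
Lemma toroidal_surj (R : realType) (x : 'rV[R]_3) :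
  0 < axis_dist2 x -> 0 < circle_dist4 x ->
  exists p, toroidal_domain p /\ toroidal_point p.1.1 p.1.2 p.2 = x.
Proof.
move=> r20 S20.
set r := Num.sqrt (axis_dist2 x); set S := Num.sqrt (circle_dist4 x).
have r2 : r ^+ 2 = axis_dist2 x by rewrite sqr_sqrtr// ltW.
have S2 : S ^+ 2 = circle_dist4 x by rewrite sqr_sqrtr// ltW.
have r0 : 0 < r by rewrite sqrtr_gt0.
have S0 : 0 < S by rewrite sqrtr_gt0.
have rN : r != 0 by rewrite gt_eqF.
have SN : S != 0 by rewrite gt_eqF.
set A := sq_normD1 x.
have A0 : 0 < A by rewrite /A /sq_normD1 -r2 ltr_wpDl// addr_ge0 ?sqr_ge0.
have AE : A = x 0 crd0 ^+ 2 + r ^+ 2 + 1 by rewrite r2.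
have SA : S ^+ 2 = A ^+ 2 - 4 * r ^+ 2 by rewrite r2.
have SltA : S < A.
  rewrite -(@ltr_pXn2r _ 2)// ?nnegrE ?ltW// SA.
  by rewrite gtrBl mulr_gt0// exprn_gt0.
have [e e0 ce] : exists2 e, 0 < e & cosh e = A / S.
  by apply: cosh_surj; rewrite ltr_pdivlMr// mul1r.
have [th [/andP[th1 th2] cth sth]] : exists t, [/\ - pi < t <= pi,
    cos t = (A - 2) / S & sin t = 2 * x 0 crd0 / S].
  apply: polar_angle; rewrite !expr_div_n -mulrDl SA AE.
  have -> : (x 0 crd0 ^+ 2 + r ^+ 2 + 1 - 2) ^+ 2 + (2 * x 0 crd0) ^+ 2 =
    (x 0 crd0 ^+ 2 + r ^+ 2 + 1) ^+ 2 - 4 * r ^+ 2 by ring.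
  by rewrite divff// -AE -SA expf_neq0.
have [ph [ph1 cph sph]] : exists t, [/\ - pi < t <= pi,
    cos t = x 0 crd1 / r & sin t = x 0 crd2 / r].
  by apply: polar_angle; rewrite !expr_div_n -mulrDl r2 divff// gt_eqF.
(* Both sides are nonnegative, so comparing squares suffices: A^2 - S^2 = 4 r^2. *)
have she : sinh e = 2 * r / S.
  apply/eqP; rewrite -(@eqrXn2 _ 2)// ?(ltW (sinh_gt0 e0))//; last first.
    by rewrite divr_ge0 ?mulr_ge0 ?(ltW r0) ?(ltW S0).
  have -> : sinh e ^+ 2 = cosh e ^+ 2 - 1 by rewrite -(cosh2Bsinh2 e); ring.
  apply/eqP; rewrite ce.
  transitivity ((A ^+ 2 - S ^+ 2) / S ^+ 2); first by field.
  by have -> : A ^+ 2 - S ^+ 2 = 4 * r ^+ 2 by [rewrite SA; ring]; field.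
exists (e, th, ph); split; first by split => //=; rewrite (ltW th1).
rewrite /= /toroidal_point ce cth sth she cph sph.
apply/rowP => i; rewrite mxE.
have -> : A / S - (A - 2) / S = 2 / S by field.
case: i => [[|[|[|//]]] Hi] /=.
- by have -> : Ordinal Hi = crd0 by [apply/val_inj]; field.
- by have -> : Ordinal Hi = crd1 by [apply/val_inj]; field; rewrite ?rN ?SN.
- by have -> : Ordinal Hi = crd2 by [apply/val_inj]; field; rewrite ?rN ?SN.
Qed.

(* With [A := sq_normD1 x], [S := sqrt (circle_dist4 x)] and
   [r := sqrt (axis_dist2 x)], one has [cosh eta = A / S],
   [cos theta = (A - 2) / S], [sin theta = 2 x_0 / S], [cos phi = x_1 / r],
   [sin phi = x_2 / r] and [cosh eta - cos theta = 2 / S]. *)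
Definition cart_harmonic (R : realType) (eta0 : R) (n m : nat) (nu mu : int)
    (x : 'rV[R]_3) : R :=
  Num.sqrt (2 / Num.sqrt (circle_dist4 x))
  * (legendreQ (n%:R - 1 / 2) m (sq_normD1 x / Num.sqrt (circle_dist4 x))
     / legendreQ (n%:R - 1 / 2) m (cosh eta0))
  * cart_Phi nu n ((sq_normD1 x - 2) / Num.sqrt (circle_dist4 x))
      (2 * x 0 crd0 / Num.sqrt (circle_dist4 x))
  * cart_Phi mu m (x 0 crd1 / Num.sqrt (axis_dist2 x))
      (x 0 crd2 / Num.sqrt (axis_dist2 x)).

(** It holds for all real th and ph, so the value is the same for every triple above a given
    point. *)
Lemma cart_harmonic_toroidal (R : realType) (eta0 : R) (n m : nat)
    (nu mu : int) (e th ph : R) : 0 < e ->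
  cart_harmonic eta0 n m nu mu (toroidal_point e th ph) =
  harmonic_coords eta0 n m nu mu e th ph.
Proof.
move=> e0; have D0 := coshBcos_gt0 th e0; have s0 := sinh_gt0 e0.
have DN := lt0r_neq0 D0; have sN := lt0r_neq0 s0.
rewrite /cart_harmonic /harmonic_coords circle_dist4_toroidal//.
rewrite axis_dist2_toroidal// sq_normD1_toroidal// !sqrtr_sqr.
rewrite !ger0_norm; [|by rewrite divr_ge0// ltW..].
rewrite !mxE /=.
have -> : 2 / (2 / (cosh e - cos th)) = cosh e - cos th by field.
have -> : 2 * cosh e / (cosh e - cos th) / (2 / (cosh e - cos th)) = cosh e.
  by field.
have -> : (2 * cosh e / (cosh e - cos th) - 2) / (2 / (cosh e - cos th)) = cos th.
  by field.
have -> : 2 * (sin th / (cosh e - cos th)) / (2 / (cosh e - cos th)) = sin th.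
  by field.
(* The identity is applied twice, once for each of cos ph and sin ph. *)
have -> a : sinh e * a / (cosh e - cos th) / (sinh e / (cosh e - cos th)) = a.
  by field; rewrite sN DN.
have -> a : sinh e * a / (cosh e - cos th) / (sinh e / (cosh e - cos th)) = a.
  by field; rewrite sN DN.
by rewrite !cart_PhiE.
Qed.

(** By surjectivity the chosen triple is a genuine one, mapped back to x by [toroidal_point];
    writing x in this way on the right makes [cart_harmonic_toroidal] applicable. *)
Lemma interior_harmonicE (R : realType) (eta0 : R) (n m : nat) (nu mu : int)
    (x : 'rV[R]_3) : 0 < axis_dist2 x -> 0 < circle_dist4 x ->
  interior_harmonic eta0 n m nu mu x = cart_harmonic eta0 n m nu mu x.
Proof.
move=> x0 x1; rewrite /interior_harmonic.
have [[e0 _ _] xE] : toroidal_domain (toroidal_coords x) /\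
    toroidal_point (toroidal_coords x).1.1 (toroidal_coords x).1.2
      (toroidal_coords x).2 = x.
  exact: xgetPex (toroidal_surj x0 x1).
by rewrite -[in RHS]xE cart_harmonic_toroidal.
Qed.

(** * Differentiability *)

(** The first-order expansion of g at x is also one of f, and [diff_unique] identifies its linear
    part with the differential of f. It carries differentiability from [cart_harmonic] to
    [interior_harmonic]. *)
Lemma near_eq_differentiable (R : numFieldType) (V W : normedModType R)
    (f g : V -> W) (x : V) :
  (\forall y \near x, f y = g y) -> differentiable g x -> differentiable f x.
Proof.
move=> fg dg; have fgx : f x = g x by exact: nbhs_singleton fg.
have fE : f \o shift x = cst (f x) + 'd g x +o_ 0 id.
  apply/eqaddoP => _/posnumP[e].
  have /diff_locally/eqaddoP/(_ e%:num) := dg.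
  move=> /(_ [gt0 of e%:num]) ge.
  have fg0 : \forall h \near 0, f (h + x) = g (h + x).
    by move: fg; rewrite [X in X -> _](near_shift 0) subr0.
  apply: filterS2 fg0 ge => h fgh.
  by rewrite !fctE /= fgh fgx.
have dc : continuous ('d g x) by exact: diff_continuous.
by apply/diff_locallyP; rewrite (diff_unique dc fE).
Qed.

Lemma differentiable_is_derive_comp (R : realType) (V : normedModType R)
    (f : V -> R) (g : R -> R) (d : R) (x : V) :
  differentiable f x -> is_derive (f x) 1 g d ->
  differentiable (fun y => g (f y)) x.
Proof.
move=> df dg; apply: (@differentiable_comp _ _ _ _ f g) => //.
exact/derivable1_diffP/ex_derive.
Qed.

Lemma differentiable_exprn (R : realType) (V : normedModType R) (f : V -> R)
    (n : nat) (x : V) : differentiable f x -> differentiable (fun y => f y ^+ n) x.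
Proof.
move=> df; apply: (@differentiable_comp _ _ _ _ f (fun t : R => t ^+ n)) => //.
exact/derivable1_diffP/exprn_derivable.
Qed.

Lemma differentiable_multiple_angle (R : realType) (V : normedModType R)
    (c s : V -> R) (n : nat) (x : V) :
  differentiable c x -> differentiable s x ->
  differentiable (fun y => (multiple_angle n (c y) (s y)).1) x /\
  differentiable (fun y => (multiple_angle n (c y) (s y)).2) x.
Proof.
move=> dc ds; elim: n => [|n [IH1 IH2]] /=.
  by split; exact: differentiable_cst.
split.
  by apply: differentiableB; exact: differentiableM.
by apply: differentiableD; exact: differentiableM.
Qed.

Lemma differentiable_cart_Phi (R : realType) (V : normedModType R)
    (c s : V -> R) (nu : int) (n : nat) (x : V) :
  differentiable c x -> differentiable s x ->
  differentiable (fun y => cart_Phi nu n (c y) (s y)) x.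
Proof.
move=> dc ds; have [d1 d2] := differentiable_multiple_angle n dc ds.
by rewrite /cart_Phi; case: (nu == 1).
Qed.

Lemma differentiable_div (R : realType) (V : normedModType R) (f g : V -> R)
    (x : V) : differentiable f x -> differentiable g x -> g x != 0 ->
  differentiable (fun y => f y / g y) x.
Proof. by move=> df dg g0; apply: differentiableM => //; exact: differentiableV. Qed.

Lemma differentiable_axis_dist2 (R : realType) (x : 'rV[R]_3) :
  differentiable (@axis_dist2 R) x.
Proof.
by apply: differentiableD; apply: differentiable_exprn; exact: differentiable_coord.
Qed.

Lemma differentiable_sq_normD1 (R : realType) (x : 'rV[R]_3) :
  differentiable (@sq_normD1 R) x.
Proof.
apply: differentiableD; last exact: differentiable_cst.
apply: differentiableD; last exact: differentiable_axis_dist2.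
by apply: differentiable_exprn; exact: differentiable_coord.
Qed.

Lemma differentiable_circle_dist4 (R : realType) (x : 'rV[R]_3) :
  differentiable (@circle_dist4 R) x.
Proof.
apply: differentiableB.
  by apply: differentiable_exprn; exact: differentiable_sq_normD1.
apply: differentiableM; first exact: differentiable_cst.
exact: differentiable_axis_dist2.
Qed.

(** The first two conditions keep the square roots and quotients smooth; the third says cosh eta >
    1, as the derivative of Q requires. *)
Lemma differentiable_cart_harmonic (R : realType) (eta0 : R) (n m : nat)
    (nu mu : int) (x : 'rV[R]_3) :
  0 < axis_dist2 x -> 0 < circle_dist4 x ->
  1 < sq_normD1 x / Num.sqrt (circle_dist4 x) ->
  differentiable (cart_harmonic eta0 n m nu mu) x.
Proof.
move=> r0 S0 t1.
have dS : differentiable (fun y : 'rV[R]_3 => Num.sqrt (circle_dist4 y)) x.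
  exact: differentiable_is_derive_comp (differentiable_circle_dist4 x)
    (is_derive1_sqrt S0).
have dr : differentiable (fun y : 'rV[R]_3 => Num.sqrt (axis_dist2 y)) x.
  exact: differentiable_is_derive_comp (differentiable_axis_dist2 x)
    (is_derive1_sqrt r0).
have SN : Num.sqrt (circle_dist4 x) != 0 by rewrite gt_eqF// sqrtr_gt0.
have rN : Num.sqrt (axis_dist2 x) != 0 by rewrite gt_eqF// sqrtr_gt0.
have dx i : differentiable (fun y : 'rV[R]_3 => y 0 i) x.
  exact: differentiable_coord.
have k1 : -1 < n%:R - 1 / 2 :> R by have := ler0n R n; lra.
have dt : differentiable
    (fun y : 'rV[R]_3 => sq_normD1 y / Num.sqrt (circle_dist4 y)) x.
  by apply: differentiable_div => //; exact: differentiable_sq_normD1.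
have dQ := differentiable_is_derive_comp dt (is_derive_legendreQ m k1 t1).
apply: differentiableM; last first.
  by apply: differentiable_cart_Phi; apply: differentiable_div.
apply: differentiableM; last first.
  apply: differentiable_cart_Phi; apply: differentiable_div => //.
    apply: differentiableB; last exact: differentiable_cst.
    exact: differentiable_sq_normD1.
  apply: differentiableM => //; exact: differentiable_cst.
apply: differentiableM.
  have d2S : differentiable
      (fun y : 'rV[R]_3 => 2 / Num.sqrt (circle_dist4 y)) x.
    by apply: differentiable_div => //; exact: differentiable_cst.
  have S20 : 0 < 2 / Num.sqrt (circle_dist4 x) by rewrite divr_gt0// sqrtr_gt0.
  exact: differentiable_is_derive_comp d2S (is_derive1_sqrt S20).
apply: differentiableM; last exact: differentiable_cst.
exact: dQ.
Qed.

(** * The normal derivative in toroidal coordinates *)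

(** The gradient is built from partial derivatives; differentiability is what makes the derivative
    along v linear in v. *)
Lemma dot_gradient (R : realType) (f : 'rV[R]_3 -> R) (x v : 'rV[R]_3) :
  differentiable f x -> dot (gradient f x) v = 'd f x v.
Proof.
move=> df; rewrite [in RHS](row_sum_delta v) linear_sum; apply: eq_bigr => i _.
by rewrite mxE deriveE// linearZ mulrC.
Qed.

Lemma dotZr (R : realType) (c : R) (u v : 'rV[R]_3) :
  dot u (c *: v) = c * dot u v.
Proof. by rewrite /dot mulr_sumr; apply: eq_bigr => i _; rewrite mxE mulrCA. Qed.

Lemma is_derive_cosh (R : realType) (e : R) : is_derive e 1 (@cosh R) (sinh e).
Proof.
rewrite /cosh /sinh; apply: is_derive_eq.
by rewrite /GRing.scale/=; field.
Qed.

Lemma is_derive_sinh (R : realType) (e : R) : is_derive e 1 (@sinh R) (cosh e).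
Proof.
rewrite /cosh /sinh; apply: is_derive_eq.
by rewrite /GRing.scale/=; field.
Qed.

Lemma is_derive_div (R : realType) (f g : R -> R) (x df dg : R) :
  is_derive x 1 f df -> is_derive x 1 g dg -> g x != 0 ->
  is_derive x 1 (fun t => f t / g t) ((df * g x - f x * dg) / g x ^+ 2).
Proof.
move=> Df Dg g0.
have DV : is_derive x 1 (fun t => (g t)^-1) (- (g x) ^- 2 * dg).
  exact: is_deriveV.
apply: is_derive_eq (is_derive_mul Df DV) _.
by field.
Qed.

(** The vector x_eta, with its last two entries simplified by cosh e D - sinh^2 e = 1 - cosh e cos
    th. *)
Definition toroidal_tangent (R : realType) (e th ph : R) : 'rV[R]_3 :=
  let D := cosh e - cos th in
  \row_(i < 3) [:: - (sin th * sinh e) / D ^+ 2;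
                   (1 - cosh e * cos th) * cos ph / D ^+ 2;
                   (1 - cosh e * cos th) * sin ph / D ^+ 2]`_i.

Lemma is_derive_toroidal_point (R : realType) (e th ph : R) : 0 < e ->
  is_derive e 1 (fun e => toroidal_point e th ph) (toroidal_tangent e th ph).
Proof.
move=> e0; have DN := lt0r_neq0 (coshBcos_gt0 th e0).
have dD : is_derive e 1 (fun e : R => cosh e - cos th) (sinh e).
  have := is_deriveB (is_derive_cosh e) (is_derive_cst (cos th) e 1).
  by rewrite subr0.
have ds c : is_derive e 1 (fun e : R => sinh e * c) (cosh e * c).
  have := is_derive_mul (is_derive_sinh e) (is_derive_cst c e 1).
  by rewrite mulr0 addr0.
have sh2 : sinh e ^+ 2 = cosh e ^+ 2 - 1 by rewrite -(cosh2Bsinh2 e); ring.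
have dcoord (i : 'I_3) : is_derive e 1 (fun e => toroidal_point e th ph 0 i)
    (toroidal_tangent e th ph 0 i).
  rewrite mxE; under eq_fun do rewrite mxE.
  case: i => [[|[|[|//]]] Hi] /=.
  - have dc : is_derive e 1 (fun _ : R => sin th) 0 by exact: is_derive_cst.
    apply: is_derive_eq (is_derive_div dc dD DN) _.
    by field.
  - apply: is_derive_eq (is_derive_div (ds (cos ph)) dD DN) _.
    transitivity ((cosh e * (cosh e - cos th) - sinh e ^+ 2) * cos ph
      / (cosh e - cos th) ^+ 2); first by field.
    by rewrite sh2; field.
  - apply: is_derive_eq (is_derive_div (ds (sin ph)) dD DN) _.
    transitivity ((cosh e * (cosh e - cos th) - sinh e ^+ 2) * sin ph
      / (cosh e - cos th) ^+ 2); first by field.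
    by rewrite sh2; field.
have dX : derivable (fun e => toroidal_point e th ph) e 1.
  by apply/derivable_mxP => i j; rewrite (ord1 i); have [] := dcoord j.
split; first exact: dX.
rewrite derive_mx//; apply/rowP => i; rewrite mxE.
by have [] := dcoord i.
Qed.

(** The squared norm has numerator sin^2 th sinh^2 e + (1 - cosh e cos th)^2 = (cosh e - cos th)^2
    over the fourth power of cosh e - cos th. *)
Lemma euclidean_norm_tangent (R : realType) (e th ph : R) : 0 < e ->
  euclidean_norm (toroidal_tangent e th ph) = (cosh e - cos th)^-1.
Proof.
move=> e0; have D0 := coshBcos_gt0 th e0; have DN := lt0r_neq0 D0.
rewrite /euclidean_norm.
have -> : dot (toroidal_tangent e th ph) (toroidal_tangent e th ph) =
    (cosh e - cos th) ^- 2.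
  have sh2 : sinh e ^+ 2 = cosh e ^+ 2 - 1 by rewrite -(cosh2Bsinh2 e); ring.
  rewrite /dot !big_ord_recl big_ord0 !mxE /=.
  transitivity ((sin th ^+ 2 * sinh e ^+ 2 + (1 - cosh e * cos th) ^+ 2 *
    (cos ph ^+ 2 + sin ph ^+ 2)) / (cosh e - cos th) ^+ 4); first by field.
  rewrite cos2Dsin2 sin2cos2 sh2; field.
  exact: DN.
by rewrite -exprVn sqrtr_sqr ger0_norm// invr_ge0 ltW.
Qed.

(** Positivity of [axis_dist2] and [circle_dist4] is an open condition, so the harmonic agrees with
    [cart_harmonic] on a whole neighbourhood of the point. *)
Lemma differentiable_interior_harmonic (R : realType) (eta0 : R) (n m : nat)
    (nu mu : int) (e th ph : R) : 0 < e ->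
  differentiable (interior_harmonic eta0 n m nu mu) (toroidal_point e th ph).
Proof.
move=> e0; set x := toroidal_point e th ph.
have r0 : 0 < axis_dist2 x by exact: axis_dist2_toroidal_gt0.
have S0 : 0 < circle_dist4 x by exact: circle_dist4_toroidal_gt0.
apply: (@near_eq_differentiable _ _ _ _ (cart_harmonic eta0 n m nu mu)).
  have cr := differentiable_continuous (differentiable_axis_dist2 x).
  have cS := differentiable_continuous (differentiable_circle_dist4 x).
  near=> y; apply: interior_harmonicE; near: y.
    exact: cvgr_gt cr _ r0.
  exact: cvgr_gt cS _ S0.
apply: differentiable_cart_harmonic => //.
have D0 := coshBcos_gt0 th e0; have DN := lt0r_neq0 D0.
rewrite /x circle_dist4_toroidal// sq_normD1_toroidal// sqrtr_sqr.
rewrite ger0_norm; last by rewrite divr_ge0// ltW.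
have -> : 2 * cosh e / (cosh e - cos th) / (2 / (cosh e - cos th)) = cosh e.
  by field.
exact: cosh_gt1.
Unshelve. all: by end_near. Qed.

Lemma nor_interior_harmonic (R : realType) (eta0 : R) (n m : nat)
    (nu mu : int) (th ph : R) : 0 < eta0 ->
  nor (interior_harmonic eta0 n m nu mu) eta0 th ph =
  (cosh eta0 - cos th) *
    'D_1 (fun e => harmonic_coords eta0 n m nu mu e th ph) eta0.
Proof.
move=> e0; set f := interior_harmonic eta0 n m nu mu.
have df : differentiable f (toroidal_point eta0 th ph).
  exact: differentiable_interior_harmonic.
have dX := is_derive_toroidal_point th ph e0.
have dX' : differentiable (fun e => toroidal_point e th ph) eta0.
  exact/derivable1_diffP/ex_derive.
have xE : (fun e => toroidal_point e th ph)^`()%classic eta0 =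
    toroidal_tangent eta0 th ph.
  by rewrite derive1E; exact: derive_val.
rewrite /nor /inward_normal xE dotZr.
rewrite euclidean_norm_tangent// invrK dot_gradient//; congr (_ * _).
(* Chain rule along the coordinate curve with th and ph fixed. *)
transitivity ('D_1 (f \o (fun e => toroidal_point e th ph)) eta0).
  rewrite deriveE; last exact: differentiable_comp.
  rewrite diff_comp//=; congr ('d f _ _).
  by rewrite -xE derive1E deriveE.
(* All e near eta0 are positive, so along the curve the harmonic is [harmonic_coords] at e, th, ph,
   whichever coordinates [toroidal_coords] returns. *)
apply: near_eq_derive.
near=> e; rewrite /f /= interior_harmonicE.
- by rewrite cart_harmonic_toroidal//; near: e; exact: lt_nbhsr.
- by apply: axis_dist2_toroidal_gt0; near: e; exact: lt_nbhsr.
- by apply: circle_dist4_toroidal_gt0; near: e; exact: lt_nbhsr.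
Unshelve. all: by end_near. Qed.

(** With t = cosh eta0, the denominator t^2 - 1 = sinh^2 eta0 of the derivative of Q loses one
    factor to the sinh eta0 of the chain rule. *)
Lemma is_derive_harmonic_coords (R : realType) (eta0 : R) (n m : nat)
    (nu mu : int) (th ph : R) : 0 < eta0 ->
  is_derive eta0 1 (fun e => harmonic_coords eta0 n m nu mu e th ph)
    ((sinh eta0 / (2 * Num.sqrt (cosh eta0 - cos th))
      + Num.sqrt (cosh eta0 - cos th)
        * ((n%:R - m%:R + 1 / 2)
           * (legendreQ (n%:R + 1 / 2) m (cosh eta0)
              / legendreQ (n%:R - 1 / 2) m (cosh eta0))
           - (n%:R + 1 / 2) * cosh eta0) / sinh eta0)
     * Phi nu n%:Z th * Phi mu m%:Z ph).
Proof.
move=> e0; set k : R := n%:R - 1 / 2.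
have k1 : -1 < k by rewrite /k; have := ler0n R n; lra.
have -> : n%:R + 1 / 2 = k + 1 by rewrite /k; field.
have -> : n%:R - m%:R + 1 / 2 = k - m%:R + 1 by rewrite /k; field.
have c1 := cosh_gt1 e0.
have QN := legendreQ_neq0 m k1 c1.
have D0 := coshBcos_gt0 th e0.
have s0 := lt0r_neq0 (sinh_gt0 e0).
have sN : Num.sqrt (cosh eta0 - cos th) != 0 by rewrite gt_eqF// sqrtr_gt0.
have sh2 : cosh eta0 ^+ 2 - 1 = sinh eta0 ^+ 2.
  by rewrite -(cosh2Bsinh2 eta0); ring.
have dc := is_derive_cosh eta0.
have dD : is_derive eta0 1 (fun e : R => cosh e - cos th) (sinh eta0).
  have := is_deriveB dc (is_derive_cst (cos th) eta0 1).
  by rewrite subr0.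
have dsq : is_derive eta0 1 (fun e : R => Num.sqrt (cosh e - cos th)) _ :=
  @is_derive1_comp _ _ (fun e : R => cosh e - cos th) _ _ _
    (is_derive1_sqrt D0) dD.
have dQ : is_derive eta0 1 (fun e : R => legendreQ k m (cosh e)) _ :=
  @is_derive1_comp _ _ (@cosh R) _ _ _ (is_derive_legendreQ m k1 c1) dc.
have dcst (c : R) : is_derive eta0 1 (fun _ : R => c) 0 by exact: is_derive_cst.
have dQ0 := is_derive_mul dQ (dcst (legendreQ k m (cosh eta0))^-1).
have d1 := is_derive_mul dsq dQ0.
have d2 := is_derive_mul d1 (dcst (Phi nu n%:Z th)).
have d3 := is_derive_mul d2 (dcst (Phi mu m%:Z ph)).
apply: is_derive_eq d3 _.
rewrite sh2; clearbody k.
move: (legendreQ k m (cosh eta0)) (legendreQ (k + 1) m (cosh eta0)) QN.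
move=> Q Q1 QN; field.
by rewrite QN s0 sN.
Qed.

(** Multiplication by cos th shifts the index both ways, which is how n - 1 and n + 1 enter. The
    integer index covers n = 0, where n - 1 is -1. *)
Lemma Phi_neighbours (R : realType) (nu k : int) (th : R) :
  Phi nu (k - 1) th + Phi nu (k + 1) th = 2 * cos th * Phi nu k th.
Proof.
rewrite /Phi rmorphB rmorphD /= mulrBl mulrDl mul1r cosB cosD sinB sinD.
by case: ifP => _; ring.
Qed.

Theorem lemma3p1 (R : realType) (eta0 : R) (n m : nat) (nu mu : int)
    (heta0 : 0 < eta0) (hnu : nu = 1 \/ nu = -1) (hmu : mu = 1 \/ mu = -1)
    (theta phi : R) (htheta : - pi <= theta <= pi) (hphi : - pi < phi <= pi) :
  differentiable (interior_harmonic eta0 n m nu mu)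
    (toroidal_point eta0 theta phi) /\
  nor (interior_harmonic eta0 n m nu mu) eta0 theta phi =
    Num.sqrt (cosh eta0 - cos theta) / (4 * sinh eta0) * Phi mu m%:Z phi
    * (nor_coefA eta0 n m * Phi nu (n%:Z - 1) theta
       + nor_coefB eta0 n m * Phi nu n%:Z theta
       + nor_coefA eta0 n m * Phi nu (n%:Z + 1) theta).
Proof.
split; first exact: differentiable_interior_harmonic.
rewrite nor_interior_harmonic//.
rewrite (@derive_val _ _ _ _ _ _ _
  (is_derive_harmonic_coords n m nu mu theta phi heta0)).
have D0 := coshBcos_gt0 theta heta0.
have -> (a b : R) : a * Phi nu (n%:Z - 1) theta + b * Phi nu n%:Z theta
    + a * Phi nu (n%:Z + 1) theta = (2 * a * cos theta + b) * Phi nu n%:Z theta.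
  by rewrite addrAC -mulrDr Phi_neighbours; ring.
rewrite /nor_coefA /nor_coefB.
set rho := _ / legendreQ _ _ _.
set r := Num.sqrt _; set c := cosh eta0; set s := sinh eta0.
have rN : r != 0 by rewrite gt_eqF// sqrtr_gt0.
have sN : s != 0 by rewrite gt_eqF// sinh_gt0.
have r2 : c - cos theta = r ^+ 2 by rewrite sqr_sqrtr// ltW.
(* With cos theta eliminated, both sides become rational in r, c and s. *)
have cosE : cos theta = c - r ^+ 2 by rewrite -r2; ring.
have s2 : s ^+ 2 = c ^+ 2 - 1 by rewrite -(cosh2Bsinh2 eta0) /c /s; ring.
rewrite r2 cosE.
(* In 2 A cos theta + B the part free of r is 2 A c + B, where the terms in n and rho cancel and 2
   c^2 - 2 = 2 s^2 is left; the remaining part is - 2 A r^2. *)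
transitivity (r / (4 * s) * Phi mu m%:Z phi * Phi nu n%:Z theta *
  (2 * s ^+ 2 + 4 * r ^+ 2 *
    ((n%:R - m%:R + 1 / 2) * rho - (n%:R + 1 / 2) * c))).
  by field; rewrite rN sN.
by rewrite s2; field.
Qed.
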